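(* Let $a\in\mathbb{R}\setminus\{0\}$ and $\hat m_1,\hat m_2,f\in\mathbb{R}$. The spherical mechanical billiard system defined on $\mathcal{S}^3$ by the spherical Lagrange problem, with any finite combination (finite union) of spherical confocal quadrics with foci at the two non-antipodal Kepler centers $Z_1,Z_2$ as reflection walls, is integrable. As subcases, the billiard systems with such walls defined on $\mathcal{S}^3$ by the spherical two-center problem ($f=0$), by the spherical Kepler problem ($\hat m_1=f=0$ or $\hat m_2=f=0$; one of the foci is then a Kepler center), and by the spherical Hooke problem ($\hat m_1=\hat m_2=0$; the quadrics are then centered at a Hooke center) are integrable. The first integrals are $$E_{sph}=\tfrac12\|q'\|^2-\hat m_1\cot\theta_{Z_1}-\hat m_2\cot\theta_{Z_2}-f\tan^2\theta_{Z_0},$$ $$\hat E_{sp}=\frac{(q_4q_1'-q_1q_4')^2}{2(1+a^2)}+\frac{(q_4q_2'-q_2q_4')^2}{2}+\frac{(q_4q_3'-q_3q_4')^2}{2}-f\Big(\frac{q_1^2}{(1+a^2)q_4^2}+\frac{q_2^2+q_3^2}{q_4^2}\Big)+\frac{m_1q_4}{\sqrt{\frac{(q_1+aq_4)^2}{1+a^2}+q_2^2+q_3^2}}+\frac{m_2q_4}{\sqrt{\frac{(q_1-aq_4)^2}{1+a^2}+q_2^2+q_3^2}},$$ $$\hat L_{yz}=q_3q_2'-q_2q_3',$$ where $m_i=\hat m_i/\sqrt{1+a^2}$.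
   Context: A natural mechanical system $(M,g,U)$ is a Riemannian manifold $(M,g)$ with a force function $U$ (smooth outside a singular set); its motions satisfy $\nabla_{q'}q'=\mathrm{grad}_g U(q)$, where $'$ is the time derivative. A first integral is a function on $TM$ constant along motions. Poisson brackets of functions on $TM$ are those obtained from the canonical bracket of $T^*M$ via $v\mapsto g(v,\cdot)$. The elastic reflection at a point $q$ of a hypersurface $\mathcal{B}$ sends $v=v_t+v_n$ to $v'=v_t-v_n$ ($v_t$ tangent, $v_n$ $g$-normal to $\mathcal{B}$). The billiard system $(M,g,U,\mathcal{B})$, $\dim M=N$, is integrable if there are $N$ functionally independent first integrals of $(M,g,U)$ (differentials linearly independent on an open dense set), pairwise in involution, each satisfying $F(q,v)=F(q,v')$ for all reflections at $\mathcal{B}$. For a finite union of quadrics, reflections are considered at every point (outside singularities of $U$) of each quadric with respect to the tangent space of that quadric. $\mathcal{S}^3\subset\mathbb{R}^4$ is the unit sphere with the round metric, coordinates $(q_1,q_2,q_3,q_4)$. Kepler centers $Z_1=(\frac{a}{\sqrt{1+a^2}},0,0,-\frac1{\sqrt{1+a^2}})$, $Z_2=(-\frac{a}{\sqrt{1+a^2}},0,0,-\frac1{\sqrt{1+a^2}})$ (together with their antipodal points), Hooke center $Z_0=(0,0,0,-1)$ (and its antipode). The spherical Lagrange problem on $\mathcal{S}^3$ has force function $U(q)=\hat m_1\cot\theta_{Z_1}+\hat m_2\cot\theta_{Z_2}+f\tan^2\theta_{Z_0}$, where $\theta_Z=\angle qOZ\in[0,\pi]$; it is singular at the Kepler centers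 and their antipodes and, if $f\neq0$, on the equator $\{q_4=0\}$. A spherical confocal quadric is a non-degenerate quadric on $\mathcal{S}^3$ which is the locus of points for which the sum $\theta_{Z_1}+\theta_{Z_2}$ is a constant $c$, $d<c<2\pi-d$, $c\neq\pi$ (spheroid), or $|\theta_{Z_1}-\theta_{Z_2}|$ is a constant $c$, $0<c<d$ (circular hyperboloid of two sheets), where $d$ is the spherical distance between $Z_1$ and $Z_2$. *)

(* Defs.v *)
From HB Require Import structures.
From mathcomp Require Import all_boot all_order all_algebra.
From mathcomp Require Import all_classical all_reals all_analysis.

Set Implicit Arguments.
Unset Strict Implicit.
Unset Printing Implicit Defensive.

Import Order.TTheory GRing.Theory Num.Theory.
Import numFieldNormedType.Exports.

Local Open Scope classical_set_scope.
Local Open Scope ring_scope.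

(* The differential at x of the restriction of F to A.  For a submanifold A
   it is determined by this exactly on the tangent space of A at x; the values
   of F outside A play no role. *)
Definition is_diff_on (R : realType) (V : normedModType R) (A : set V)
    (F : V -> R) (x : V) (L : V -> R) : Prop :=
  scalar L /\
  forall eps : R, 0 < eps ->
    \forall y \near within A (nbhs x),
      `|F y - F x - L (y - x)| <= eps * `|y - x|.

(* The norm of 'rV[R]_n in the library is the sup norm, which gives the usual
   topology and derivatives; Euclidean lengths are expressed through dotr. *)
Definition dotr (R : realType) (n : nat) (u v : 'rV[R]_n) : R :=
  \sum_i u ord0 i * v ord0 i.

Definition sphere (R : realType) (n : nat) : set 'rV[R]_n.+1 :=
  [set q | dotr q q = 1].

(* Theory of natural mechanical systems on the round sphere S^n of R^(n+1).
   Sing is the singular set of the force function; a point of the tangent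
   bundle is a pair (q, v) with q on S^n and v orthogonal to q. *)

Definition config (R : realType) (n : nat) (Sing : set 'rV[R]_n.+1) :
    set 'rV[R]_n.+1 := sphere (n := n) `\` Sing.

Definition phase (R : realType) (n : nat) (Sing : set 'rV[R]_n.+1) :
    set ('rV[R]_n.+1 * 'rV[R]_n.+1) :=
  [set x | config Sing x.1 /\ dotr x.1 x.2 = 0].

(* Linearization at x = (q, v) of the equations <q, q> = 1, <q, v> = 0. *)
Definition phase_tangent (R : realType) (n : nat)
    (x : 'rV[R]_n.+1 * 'rV[R]_n.+1) : set ('rV[R]_n.+1 * 'rV[R]_n.+1) :=
  [set xi | dotr x.1 xi.1 = 0 /\ dotr xi.1 x.2 + dotr x.1 xi.2 = 0].

Definition is_grad (R : realType) (n : nat) (Sing : set 'rV[R]_n.+1)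
    (U : 'rV[R]_n.+1 -> R) (q G : 'rV[R]_n.+1) : Prop :=
  dotr q G = 0 /\ is_diff_on (config Sing) U q (dotr G).

(* The covariant derivative of q' along a curve q on the sphere is the
   tangential part of q''. *)
Definition covariant_acc (R : realType) (n : nat)
    (q : R -> 'rV[R]_n.+1) (t : R) : 'rV[R]_n.+1 :=
  derive1 (derive1 q) t - dotr (derive1 (derive1 q) t) (q t) *: q t.

Definition is_motion (R : realType) (n : nat) (U : 'rV[R]_n.+1 -> R)
    (Sing : set 'rV[R]_n.+1) (I : set R) (q : R -> 'rV[R]_n.+1) : Prop :=
  [/\ open I, is_interval I &
      forall t, I t ->
        [/\ config Sing (q t), derivable q t 1, derivable (derive1 q) t 1 &
            is_grad Sing U (q t) (covariant_acc q t)]].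

Definition first_integral (R : realType) (n : nat) (U : 'rV[R]_n.+1 -> R)
    (Sing : set 'rV[R]_n.+1) (F : 'rV[R]_n.+1 * 'rV[R]_n.+1 -> R) : Prop :=
  forall (I : set R) (q : R -> 'rV[R]_n.+1), is_motion U Sing I q ->
  forall s t, I s -> I t -> F (q s, derive1 q s) = F (q t, derive1 q t).

(* The pullback to TS^n, by v |-> g(v, .), of the Liouville form of T*S^n is
   the restriction of \sum_i v_i dq_i; hence the canonical symplectic form is
   the restriction of \sum_i dq_i /\ dv_i to the tangent spaces of TS^n. *)
Definition symp (R : realType) (n : nat)
    (xi eta : 'rV[R]_n.+1 * 'rV[R]_n.+1) : R :=
  dotr xi.1 eta.2 - dotr xi.2 eta.1.

Definition is_hamiltonian_vector (R : realType) (n : nat)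
    (Sing : set 'rV[R]_n.+1) (F : 'rV[R]_n.+1 * 'rV[R]_n.+1 -> R)
    (x X : 'rV[R]_n.+1 * 'rV[R]_n.+1) : Prop :=
  phase_tangent x X /\
  exists2 L, is_diff_on (phase Sing) F x L &
    forall xi, phase_tangent x xi -> L xi = symp X xi.

(* {F, G}(x) = r, with the sign convention {q, p} = 1. *)
Definition is_poisson (R : realType) (n : nat) (Sing : set 'rV[R]_n.+1)
    (F G : 'rV[R]_n.+1 * 'rV[R]_n.+1 -> R)
    (x : 'rV[R]_n.+1 * 'rV[R]_n.+1) (r : R) : Prop :=
  exists XF XG, [/\ is_hamiltonian_vector Sing F x XF,
    is_hamiltonian_vector Sing G x XG & r = symp XF XG].

Definition in_involution (R : realType) (n : nat) (Sing : set 'rV[R]_n.+1)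
    (F G : 'rV[R]_n.+1 * 'rV[R]_n.+1 -> R) : Prop :=
  forall x, phase Sing x -> is_poisson Sing F G x 0.

Definition independent_at (R : realType) (n k : nat) (Sing : set 'rV[R]_n.+1)
    (F : k.-tuple ('rV[R]_n.+1 * 'rV[R]_n.+1 -> R))
    (x : 'rV[R]_n.+1 * 'rV[R]_n.+1) : Prop :=
  exists L : 'I_k -> 'rV[R]_n.+1 * 'rV[R]_n.+1 -> R,
    (forall i, is_diff_on (phase Sing) (tnth F i) x (L i)) /\
    (forall c : 'I_k -> R,
      (forall xi, phase_tangent x xi -> \sum_i c i * L i xi = 0) ->
      forall i, c i = 0).

Definition functionally_independent (R : realType) (n k : nat)
    (Sing : set 'rV[R]_n.+1)
    (F : k.-tuple ('rV[R]_n.+1 * 'rV[R]_n.+1 -> R)) : Prop :=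
  exists O : set ('rV[R]_n.+1 * 'rV[R]_n.+1),
    [/\ open O, phase Sing `<=` closure (phase Sing `&` O) &
        forall x, phase Sing x -> O x -> independent_at Sing F x].

(* Velocities at q of curves in B; the tangent space when B is a submanifold. *)
Definition tangent_to (R : realType) (n : nat) (B : set 'rV[R]_n.+1)
    (q : 'rV[R]_n.+1) : set 'rV[R]_n.+1 :=
  [set w | exists gamma : R -> 'rV[R]_n.+1,
     [/\ gamma 0 = q, \forall t \near (0 : R), B (gamma t) &
         is_derive (0 : R) (1 : R) gamma w]].

Definition reflects (R : realType) (n : nat) (B : set 'rV[R]_n.+1)
    (q v v' : 'rV[R]_n.+1) : Prop :=
  exists vt vn : 'rV[R]_n.+1,
    [/\ tangent_to B q vt,
        dotr q vn = 0 /\ (forall w, tangent_to B q w -> dotr w vn = 0),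
        v = vt + vn & v' = vt - vn].

Definition reflection_invariant (R : realType) (n : nat)
    (Sing B : set 'rV[R]_n.+1)
    (F : 'rV[R]_n.+1 * 'rV[R]_n.+1 -> R) : Prop :=
  forall q v v', config Sing q -> B q -> reflects B q v v' ->
    F (q, v) = F (q, v').

(* F is a complete set of integrals of the billiard whose walls are the
   union of the hypersurfaces B j, j < k, each one being reflected at with
   respect to its own tangent spaces. *)
Definition integrable_with (R : realType) (n k : nat) (U : 'rV[R]_n.+1 -> R)
    (Sing : set 'rV[R]_n.+1) (B : 'I_k -> set 'rV[R]_n.+1)
    (F : n.-tuple ('rV[R]_n.+1 * 'rV[R]_n.+1 -> R)) : Prop :=
  [/\ forall i, first_integral U Sing (tnth F i),
      functionally_independent Sing F,
      forall i j, in_involution Sing (tnth F i) (tnth F j) &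
      forall i j, reflection_invariant Sing (B j) (tnth F i)].

Definition billiard_integrable (R : realType) (n k : nat)
    (U : 'rV[R]_n.+1 -> R) (Sing : set 'rV[R]_n.+1)
    (B : 'I_k -> set 'rV[R]_n.+1) : Prop :=
  exists F : n.-tuple ('rV[R]_n.+1 * 'rV[R]_n.+1 -> R),
    integrable_with U Sing B F.

Definition row4 (R : realType) (x1 x2 x3 x4 : R) : 'rV[R]_4 :=
  \row_(i < 4) [:: x1; x2; x3; x4]`_i.

(* Coordinates are numbered from 1. *)
Definition crd (R : realType) (k : nat) (q : 'rV[R]_4) : R :=
  q ord0 (inord k.-1).

Definition Z1 (R : realType) (a : R) : 'rV[R]_4 :=
  row4 (a / Num.sqrt (1 + a ^+ 2)) 0 0 (- (1 / Num.sqrt (1 + a ^+ 2))).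

Definition Z2 (R : realType) (a : R) : 'rV[R]_4 :=
  row4 (- (a / Num.sqrt (1 + a ^+ 2))) 0 0 (- (1 / Num.sqrt (1 + a ^+ 2))).

Definition Z0 (R : realType) : 'rV[R]_4 := row4 0 0 0 (- 1).

Definition theta (R : realType) (n : nat) (Z q : 'rV[R]_n.+1) : R :=
  acos (dotr q Z).

Definition cot (R : realType) (x : R) : R := cos x / sin x.

Definition lagrange_force (R : realType) (a mh1 mh2 f : R) (q : 'rV[R]_4) : R :=
  mh1 * cot (theta (Z1 a) q) + mh2 * cot (theta (Z2 a) q)
  + f * tan (theta (Z0 R) q) ^+ 2.

(* A center with zero mass is not singular, so that the sub-problems obtained
   by letting parameters vanish live on their own, larger, domains. *)
Definition lagrange_sing (R : realType) (a mh1 mh2 f : R) : set 'rV[R]_4 :=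
  [set q | [\/ mh1 != 0 /\ (q = Z1 a \/ q = - Z1 a),
               mh2 != 0 /\ (q = Z2 a \/ q = - Z2 a) |
               f != 0 /\ crd 4 q = 0]].

Definition spheroid (R : realType) (n : nat) (P Q : 'rV[R]_n.+1) (c : R) :
    set 'rV[R]_n.+1 :=
  [set q | sphere q /\ theta P q + theta Q q = c].

Definition hyperboloid (R : realType) (n : nat) (P Q : 'rV[R]_n.+1) (c : R) :
    set 'rV[R]_n.+1 :=
  [set q | sphere q /\ `|theta P q - theta Q q| = c].

(* theta P Q is the spherical distance between the foci. *)
Definition confocal_quadric (R : realType) (n : nat) (P Q : 'rV[R]_n.+1)
    (B : set 'rV[R]_n.+1) : Prop :=
  (exists c, [/\ theta P Q < c, c < 2 * pi - theta P Q, c <> pi &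
                 B = spheroid P Q c]) \/
  (exists c, [/\ 0 < c, c < theta P Q & B = hyperboloid P Q c]).

Definition E_sph (R : realType) (a mh1 mh2 f : R)
    (x : 'rV[R]_4 * 'rV[R]_4) : R :=
  dotr x.2 x.2 / 2 - mh1 * cot (theta (Z1 a) x.1)
  - mh2 * cot (theta (Z2 a) x.1) - f * tan (theta (Z0 R) x.1) ^+ 2.

Definition Ehat_sp (R : realType) (a mh1 mh2 f : R)
    (x : 'rV[R]_4 * 'rV[R]_4) : R :=
  let q1 := crd 1 x.1 in let q2 := crd 2 x.1 in
  let q3 := crd 3 x.1 in let q4 := crd 4 x.1 in
  let v1 := crd 1 x.2 in let v2 := crd 2 x.2 in
  let v3 := crd 3 x.2 in let v4 := crd 4 x.2 in
  let m1 := mh1 / Num.sqrt (1 + a ^+ 2) in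
  let m2 := mh2 / Num.sqrt (1 + a ^+ 2) in
  (q4 * v1 - q1 * v4) ^+ 2 / (2 * (1 + a ^+ 2))
  + (q4 * v2 - q2 * v4) ^+ 2 / 2 + (q4 * v3 - q3 * v4) ^+ 2 / 2
  - f * (q1 ^+ 2 / ((1 + a ^+ 2) * q4 ^+ 2) + (q2 ^+ 2 + q3 ^+ 2) / q4 ^+ 2)
  + m1 * q4 / Num.sqrt ((q1 + a * q4) ^+ 2 / (1 + a ^+ 2) + q2 ^+ 2 + q3 ^+ 2)
  + m2 * q4 / Num.sqrt ((q1 - a * q4) ^+ 2 / (1 + a ^+ 2) + q2 ^+ 2 + q3 ^+ 2).

Definition Lhat_yz (R : realType) (x : 'rV[R]_4 * 'rV[R]_4) : R :=
  crd 3 x.1 * crd 2 x.2 - crd 2 x.1 * crd 3 x.2.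

Definition lagrange_integrals (R : realType) (a mh1 mh2 f : R) :
    3.-tuple ('rV[R]_4 * 'rV[R]_4 -> R) :=
  [tuple E_sph a mh1 mh2 f; Ehat_sp a mh1 mh2 f; @Lhat_yz R].

(* Main.v *)
Require Import Defs.
From HB Require Import structures.
From mathcomp Require Import all_boot all_order all_algebra.
From mathcomp Require Import all_classical all_reals all_analysis.
From mathcomp Require Import ring lra.

(* In ambient coordinates the force function is a sum of functions of the linear
   forms q.Z1, q.Z2 and q4, so the ambient partial gradients alpha in q and beta
   in v of each integral are explicit.  For all three integrals beta is tangent
   to the sphere, hence the Poisson brackets on TS^3 are the canonical ones,
   alpha.beta' - beta.alpha', and so are the time derivatives along motions,
   which are the brackets with the energy.  The vanishing of these brackets
   splits into one polynomial identity per center.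

   Independence only uses the derivatives along the fibres, where the potentials
   disappear: the relevant minor is a polynomial in (q, v), and a polynomial that
   does not vanish identically on a line has nonzero values arbitrarily close to
   any point of it.

   By (cos (t1 + t2) - k) (cos (t1 - t2) - k) = c1^2 + c2^2 - 2 k c1 c2 + k^2 - 1,
   where ci = cos ti, a confocal quadric is a union of components of
   al q1^2 + be q4^2 = 1 with al + a^2 be = (1 + a^2) al be; it is this relation
   that makes the normal orthogonal to the tangent space for the kinetic part of
   Ehat_sp. *)

Set Implicit Arguments.
Unset Strict Implicit.
Unset Printing Implicit Defensive.

Import Order.TTheory GRing.Theory Num.Theory.
Import numFieldNormedType.Exports.

Local Open Scope classical_set_scope.
Local Open Scope ring_scope.

(** * Differentials relative to a set *)

Section Differentials.
Context {R : realType} {V : normedModType R}.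
Implicit Types (A : set V) (F G : V -> R).

Lemma is_diff_on_ex A F x L : is_diff x F L -> is_diff_on A F x L.
Proof.
move=> [dF <-]; split; first by move=> c u v; exact: linearP.
move=> e e0; rewrite near_withinE.
have /eqaddoP/(_ e e0) d0 := diff_locally dF.
have x0 : y - x @[y --> x] --> (0 : V).
  by rewrite -(subrr x); apply: cvgB; [exact: cvg_id|exact: cvg_cst].
have := x0 _ d0; rewrite nbhs_simpl /=; apply: filterS => y /= + _.
by rewrite !fctE /= addrNK opprD addrA.
Qed.

Lemma eq_is_diff_on A F G x L : A x -> {in A, F =1 G} ->
  is_diff_on A F x L -> is_diff_on A G x L.
Proof.
move=> Ax FG [sL dF]; split=> // e /dF; rewrite !near_withinE.
by apply: filterS => y h Ay; rewrite -!FG ?inE //; exact: h.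
Qed.

Lemma is_diff_on_comp A F (g : R -> V) t w L : is_diff_on A F (g t) L ->
  continuous L -> (\forall s \near t, A (g s)) -> is_derive t 1 g w ->
  is_derive t 1 (F \o g) (L w).
Proof.
move=> [sL dF] cL gA [dg gw].
have gcvg : h^-1 *: (g (h *: 1 + t) - g t) @[h --> 0^'] --> w.
  by rewrite -gw; exact: dg.
suff Fcvg : h^-1 *: (F (g (h *: 1 + t)) - F (g t)) @[h --> 0^'] --> L w.
  split; last exact: cvg_lim Fcvg.
  by apply/cvg_ex; exists (L w).
have LZ c u : L (c *: u) = c * L u.
  have := sL c u 0; rewrite addr0 => ->.
  by have := sL 1 0 0; rewrite scaler0 addr0 mul1r -[LHS]addr0 => /addrI <-; rewrite addr0.
have Lcvg : L (h^-1 *: (g (h *: 1 + t) - g t)) @[h --> 0^'] --> L w.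
  by apply: continuous_cvg gcvg; exact: cL.
have gc : {for t, continuous g}.
  by apply: differentiable_continuous; apply/derivable1_diffP.
rewrite -[L w]add0r.
rewrite [X in X @ _ --> _](_ : _ = (fun h : R => 
  h^-1 *: (F (g (h *: 1 + t)) - F (g t) - L (g (h *: 1 + t) - g t)) +
  L (h^-1 *: (g (h *: 1 + t) - g t)))); last first.
  by apply/funext => h; rewrite LZ -[RHS]scalerDr addrNK.
apply: cvgD => //; apply/cvgr0Pnorm_le => e e0.
(* The quotients of [g] tend to [w], so their norms end up below |w| + 1; adding 1 keeps the divisor
   positive when [w] is 0. *)
pose e' := e / (`|w| + 1).
have w0 : 0 < `|w| + 1 by rewrite ltr_wpDl.
have e'0 : 0 < e' by rewrite divr_gt0.
have h0 : (h *: 1 + t) @[h --> (0:R)^'] --> t.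
  have -> : nbhs t = nbhs (0 *: 1 + t : R) by rewrite scale0r add0r.
  apply: (cvg_trans _ (_ : (h *: 1 + t) @[h --> (0:R)] --> _)); first exact/cvg_app/nbhs_dnbhs.
  by apply: cvgD; [apply: cvgZr_tmp; exact: cvg_id|exact: cvg_cst].
have gA' : \forall h \near (0:R)^', A (g (h *: 1 + t)) by exact: h0 _ gA.
have dF' : \forall h \near (0:R)^', A (g (h *: 1 + t)) ->
   `|F (g (h *: 1 + t)) - F (g t) - L (g (h *: 1 + t) - g t)|
     <= e' * `|g (h *: 1 + t) - g t|.
  have := dF _ e'0; rewrite near_withinE => H.
  exact: (h0 _ (gc _ H)).
have qb : \forall h \near (0:R)^', `|h^-1 *: (g (h *: 1 + t) - g t)| < `|w| + 1.
  apply: (cvgr_lt _ (cvg_norm gcvg)).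
  by rewrite ltrDl.
near=> h.
have h0' : h != 0 by near: h; exact: nbhs_dnbhs_neq.
have b : `|F (g (h *: 1 + t)) - F (g t) - L (g (h *: 1 + t) - g t)|
     <= e' * `|g (h *: 1 + t) - g t|.
  by near: h; apply: filterS2 gA' dF' => h ?; apply.
rewrite normrZ (le_trans (ler_wpM2l _ b)) // mulrCA -normrZ.
rewrite -[leRHS](divfK (lt0r_neq0 w0)) -/e' ler_pM2l //.
by apply: ltW; near: h.
Unshelve. all: by end_near. Qed.

End Differentials.

(** * Euclidean products and curves *)

Section Dotr.
Context {R : realType} {n : nat}.
Implicit Types (u v w : 'rV[R]_n) (c : R).

Lemma dotrC u v : dotr u v = dotr v u.
Proof. by apply: eq_bigr => i _; rewrite mulrC. Qed.

Lemma dotrDr u v w : dotr u (v + w) = dotr u v + dotr u w.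
Proof. by rewrite -big_split; apply: eq_bigr => i _; rewrite mxE mulrDr. Qed.

Lemma dotrZr c u v : dotr u (c *: v) = c * dotr u v.
Proof. by rewrite /dotr mulr_sumr; apply: eq_bigr => i _; rewrite mxE mulrCA. Qed.

Lemma dotrNr u v : dotr u (- v) = - dotr u v.
Proof. by rewrite -scaleN1r dotrZr mulN1r. Qed.

Lemma dotrBr u v w : dotr u (v - w) = dotr u v - dotr u w.
Proof. by rewrite dotrDr dotrNr. Qed.

Lemma dotrDl u v w : dotr (u + v) w = dotr u w + dotr v w.
Proof. by rewrite dotrC dotrDr !(dotrC w). Qed.

Lemma dotrZl c u v : dotr (c *: u) v = c * dotr u v.
Proof. by rewrite dotrC dotrZr dotrC. Qed.

Lemma dotrNl u v : dotr (- u) v = - dotr u v.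
Proof. by rewrite dotrC dotrNr dotrC. Qed.

Lemma dotr0 u : dotr u 0 = 0.
Proof. by rewrite -(scale0r u) dotrZr mul0r. Qed.

Definition dotrE := (dotrDl, dotrDr, dotrNl, dotrNr, dotrZl, dotrZr, dotr0).

Lemma dotrr_ge0 u : 0 <= dotr u u.
Proof. by apply: sumr_ge0 => i _; rewrite -expr2 sqr_ge0. Qed.

Lemma dotrr_eq0 u : dotr u u = 0 -> u = 0.
Proof.
move=> /eqP; rewrite psumr_eq0; last by move=> i _; rewrite -expr2 sqr_ge0.
move=> /allP u0; apply/rowP => i; rewrite mxE; apply/eqP.
by have := u0 i (mem_index_enum _); rewrite /= mulf_eq0 orbb.
Qed.

Lemma continuous_dotr u : continuous (dotr u).
Proof.
apply: (continuous_big (op := (GRing.add : R -> R -> R))) => [|i _ v].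
  exact: add_continuous.
by apply: continuousM; [exact: cst_continuous|exact: coord_continuous].
Qed.

End Dotr.

Section Curves.
Context {R : realType} {n : nat}.
Implicit Types (g h : R -> 'rV[R]_n).

Lemma is_derive_rowP g (t : R) w : is_derive t 1 g w <->
  forall i, is_derive t 1 (fun s => g s ord0 i) (w ord0 i).
Proof.
split=> [[dg gw] i|H].
  split; first by move/derivable_mxP: dg.
  by rewrite -gw derive_mx// mxE.
have dg : derivable g t 1.
  by apply/derivable_mxP => i j; rewrite ord1; have [] := H j.
split=> //; rewrite derive_mx//; apply/rowP => i; rewrite mxE.
by have [_ ->] := H i.
Qed.

Lemma is_derive_dotr g h (t : R) w z : is_derive t 1 g w -> is_derive t 1 h z ->
  is_derive t 1 (fun s => dotr (g s) (h s)) (dotr w (h t) + dotr (g t) z).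
Proof.
move=> /is_derive_rowP gw /is_derive_rowP hz.
rewrite (_ : (fun s => _) =
  \sum_i ((fun s => g s ord0 i) * (fun s => h s ord0 i))); last first.
  by apply/funext => s; rewrite fct_sumE.
have H := is_derive_sum (fun i => is_deriveM (gw i) (hz i)).
apply: (is_derive_eq H).
by rewrite big_split [RHS]addrC (dotrC w).
Qed.

Lemma is_derive_pair (V W : normedModType R) (g : R -> V) (h : R -> W) (t : R) w z :
  is_derive t 1 g w -> is_derive t 1 h z ->
  is_derive t 1 (fun s => (g s, h s)) (w, z).
Proof.
move=> [dg gw] [dh hz].
suff H : a^-1 *: ((g (a *: 1 + t), h (a *: 1 + t)) - (g t, h t))
    @[a --> 0^'] --> (w, z).
  split; last exact: cvg_lim H.
  by apply/cvg_ex; exists (w, z).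
by rewrite -gw -hz; apply: cvg_pair; [exact: dg|exact: dh].
Qed.

End Curves.

(** * Mechanics on the sphere *)

Section Mechanics.
Context {R : realType} {n : nat}.
Local Notation V := 'rV[R]_n.+1.
Implicit Types (Sing : set V) (q v w G : V) (F : V * V -> R) (x : V * V).

Definition has_gradient Sing F x (alpha beta : V) :=
  is_diff_on (phase Sing) F x (fun xi => dotr alpha xi.1 + dotr beta xi.2).

Lemma continuous_gradient (alpha beta : V) :
  continuous (fun xi : V * V => dotr alpha xi.1 + dotr beta xi.2).
Proof.
move=> x.
have c1 : {for x, continuous (fun xi : V * V => dotr alpha xi.1)}.
  apply: (@continuous_comp _ _ _ fst (dotr alpha)); first exact: cvg_fst.
  exact: continuous_dotr.
have c2 : {for x, continuous (fun xi : V * V => dotr beta xi.2)}.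
  apply: (@continuous_comp _ _ _ snd (dotr beta)); first exact: cvg_snd.
  exact: continuous_dotr.
exact: (continuousD c1 c2).
Qed.

(** The multiple of [x.1] makes the vector tangent, and it leaves the pairing unchanged because a
    tangent [xi] has [xi.1] orthogonal to [x.1]. *)
Lemma hamiltonian_vector_gradient Sing F x alpha beta :
  phase Sing x -> dotr x.1 beta = 0 -> has_gradient Sing F x alpha beta ->
  is_hamiltonian_vector Sing F x
    (beta, - alpha + (dotr x.1 alpha - dotr beta x.2) *: x.1).
Proof.
move=> [[qq _] qv] qb dF; rewrite /sphere /= in qq; split.
  by split; rewrite //= !dotrE qq; ring.
exists (fun xi => dotr alpha xi.1 + dotr beta xi.2) => // xi [t1 t2].
by rewrite /symp /= !dotrE t1; ring.
Qed.

(** The multiples of the position in the two Hamiltonian vectors are paired with [beta] and [beta'],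
    to which the position is orthogonal, so they drop out. *)
Lemma poisson_gradient Sing F F' x alpha beta alpha' beta' :
  phase Sing x -> dotr x.1 beta = 0 -> dotr x.1 beta' = 0 ->
  has_gradient Sing F x alpha beta -> has_gradient Sing F' x alpha' beta' ->
  is_poisson Sing F F' x (dotr alpha beta' - dotr beta alpha').
Proof.
move=> px qb qb' dF dF'.
have XF := hamiltonian_vector_gradient px qb dF.
have XF' := hamiltonian_vector_gradient px qb' dF'.
do 2 eexists; split; [exact: XF|exact: XF'|].
by rewrite /symp /= !dotrE qb' (dotrC beta x.1) qb; ring.
Qed.

Lemma is_deriveZv (f : R -> R) (g : R -> V) (t df : R) w :
  is_derive t 1 f df -> is_derive t 1 g w ->
  is_derive t 1 (fun s => f s *: g s) (df *: g t + f t *: w).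
Proof.
move=> df' /is_derive_rowP gw; apply/is_derive_rowP => i.
rewrite (_ : (fun s => _) = f * (fun s => g s ord0 i)); last first.
  by apply/funext => s; rewrite mxE.
apply: (is_derive_eq (is_deriveM df' (gw i))).
by rewrite !mxE [RHS]addrC [df * _]mulrC.
Qed.

(** The line through [q] directed by [w] has squared length 1 + t^2 |w|^2, so normalizing it
    multiplies by a factor stationary at 0 and keeps the velocity. *)
Lemma sphere_curve q w : sphere q -> dotr q w = 0 ->
  exists g : R -> V, [/\ g 0 = q, forall t, sphere (g t) & is_derive (0 : R) (1 : R) g w].
Proof.
rewrite /sphere /= => qq qw.
pose u := dotr w w.
have u0 : 0 <= u by exact: dotrr_ge0.
pose r (t : R) := 1 + t ^+ 2 * u.
have r0 t : 0 < r t by rewrite ltr_wpDr // mulr_ge0 // sqr_ge0.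
exists (fun t => (Num.sqrt (r t))^-1 *: (q + t *: w)); split.
- by rewrite scale0r addr0 /r expr0n mul0r addr0 sqrtr1 invr1 scale1r.
- move=> t; rewrite !dotrE (dotrC w) qw qq.
  have s0 : Num.sqrt (r t) != 0 by rewrite gt_eqF // sqrtr_gt0.
  have ss : Num.sqrt (r t) ^+ 2 = r t by rewrite sqr_sqrtr // ltW.
  rewrite -/u (_ : _ * _ = (Num.sqrt (r t)) ^- 2 * r t); last by rewrite /r; field.
  by rewrite -[X in _ * X]ss mulVf // expf_neq0.
- have dr : is_derive (0 : R) 1 r 0.
    apply: is_derive_eq; rewrite /GRing.scale /=; ring.
  have ds : is_derive (0 : R) 1 (fun t => (Num.sqrt (r t))^-1) 0.
    have d1 : is_derive (0 : R) 1 (Num.sqrt \o r) 0.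
      by apply: (is_derive_eq (is_derive1_comp (is_derive1_sqrt (r0 0)) dr)); rewrite mulr0.
    apply: (is_derive_eq (is_deriveV _ d1)); last by rewrite /GRing.scale /= mulr0.
    by rewrite /= gt_eqF // sqrtr_gt0.
  have dl : is_derive (0 : R) 1 (fun t : R => q + t *: w) w.
    have := is_deriveZv (is_derive_id (0 : R^o) (1 : R^o)) (is_derive_cst w (0 : R^o) (1 : R^o)).
    move=> H; have := is_deriveD (is_derive_cst q (0 : R^o) (1 : R^o)) H => H'.
    by apply: (is_derive_eq H'); rewrite scaler0 addr0 add0r scale1r.
  apply: (is_derive_eq (is_deriveZv ds dl)).
  by rewrite scale0r add0r /r expr0n mul0r addr0 sqrtr1 invr1 scale1r.
Qed.

Lemma open_config_near Sing q : closed Sing -> config Sing q ->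
  \forall y \near q, ~ Sing y.
Proof.
move=> cS [_ Sq]; have oS : open (~` Sing) by rewrite openC.
exact: oS.
Qed.

(** Both values are the derivative of [U] along one spherical curve of velocity [w], which avoids
    the closed set [Sing] near 0. *)
Lemma gradient_unique Sing (U : V -> R) q w G G' : closed Sing -> config Sing q ->
  dotr q w = 0 -> is_diff_on (config Sing) U q (dotr G) ->
  is_diff_on (config Sing) U q (dotr G') -> dotr G w = dotr G' w.
Proof.
move=> cS cq qw dG dG'; have [sq _] := cq.
have [g [g0 gs dg]] := sphere_curve sq qw.
have gc : \forall s \near (0 : R), config Sing (g s).
  have gcont : {for 0, continuous g}.
    by apply: differentiable_continuous; apply/derivable1_diffP; case: dg.
  have H : \forall y \near g 0, ~ Sing y by rewrite g0; exact: open_config_near.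
  have := gcont _ H; rewrite nbhs_simpl /=.
  by apply: filterS => s /= nS; split=> //; exact: gs.
rewrite -g0 in dG dG'.
have [_ <-] := is_diff_on_comp dG (@continuous_dotr _ _ G) gc dg.
by have [_ <-] := is_diff_on_comp dG' (@continuous_dotr _ _ G') gc dg.
Qed.

Lemma derive0_constant (f : R -> R) (I : set R) : is_interval I ->
  (forall t, I t -> is_derive t 1 f 0) -> forall s t, I s -> I t -> f s = f t.
Proof.
move=> iI df s t; wlog st : s t / s <= t.
  move=> H Is It; case: (leP s t) => [st|/ltW ts]; first exact: H.
  by apply/esym; exact: H.
move=> Is It.
have Ir r : r \in `[s, t] -> I r.
  by rewrite in_itv /= => rst; exact: iI Is It _ rst.
have [r rst|| c _ ] := @MVT_segment _ f (fun=> 0) s t st.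
- by apply/df/Ir; apply: subset_itv_oo_cc.
- apply: derivable_within_continuous => r /Ir /df; by case.
by rewrite mul0r => /eqP; rewrite subr_eq0 eq_sym => /eqP.
Qed.

Lemma is_derive_derive1 (g : R -> V) (t : R) :
  derivable g t 1 -> is_derive t 1 g (derive1 g t).
Proof. by move=> dg; split; [exact: dg|exact/esym/derive1E]. Qed.

(** Along a motion [F] has derivative alpha.q' + beta.q''. A tangent beta sees only the covariant
    acceleration, which pairs with tangent vectors as [G] does; the derivative is therefore the
    bracket assumed to vanish. *)
Lemma first_integral_gradient Sing (U : V -> R) F (G : V -> V) (alpha beta : V * V -> V) :
  closed Sing ->
  (forall q, config Sing q -> is_diff_on (config Sing) U q (dotr (G q))) ->
  (forall x, phase Sing x -> has_gradient Sing F x (alpha x) (beta x)) ->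
  (forall x, phase Sing x -> dotr x.1 (beta x) = 0) ->
  (forall x, phase Sing x ->
    dotr (alpha x) x.2 + dotr (beta x) (G x.1) = 0) ->
  first_integral U Sing F.
Proof.
move=> cS dU dF qb bracket I q [oI iI mot] s t.
apply: (derive0_constant (f := fun t => F (q t, derive1 q t)) iI) => {s}t It.
have dq r : I r -> is_derive r 1 q (derive1 q r).
  by move=> /mot[_ ? _ _]; exact: is_derive_derive1.
have dv r : I r -> is_derive r 1 (derive1 q) (derive1 (derive1 q) r).
  by move=> /mot[_ _ ? _]; exact: is_derive_derive1.
have qv r : I r -> phase Sing (q r, derive1 q r).
  move=> Ir; split; first by have [] := mot _ Ir.
  (* Velocities are tangent: [dotr y y] is constant on the sphere, so its relative differential is
     0, whereas the product rule gives 2 q.q' along the motion. *)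
  have d0 : is_diff_on (sphere (n := n)) (fun y => dotr y y) (q r) (fun=> 0 : R).
    have [[sq _] _ _ _] := mot _ Ir.
    apply: (@eq_is_diff_on _ _ _ (cst 1)) => // [y|].
      by rewrite inE => ->.
    apply: is_diff_on_ex; exact: is_diff_cst.
  have Iq : \forall r' \near r, sphere (q r').
    by have := oI _ Ir; apply: filterS => r' /mot[[]].
  have [_] := is_diff_on_comp d0 (@cst_continuous _ _ _) Iq (dq _ Ir).
  have [_ ->] := is_derive_dotr (dq _ Ir) (dq _ Ir).
  by rewrite dotrC -mulr2n => /eqP; rewrite mulrn_eq0 => /eqP.
have near_phase : \forall r \near t, phase Sing (q r, derive1 q r).
  by have := oI _ It; apply: filterS => r /qv.
have px := qv _ It.
have [cq _ _ [qa dUa]] := mot _ It.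
have := is_diff_on_comp (g := fun s => (q s, derive1 q s)) (dF _ px)
  (@continuous_gradient _ _) near_phase (is_derive_pair (dq _ It) (dv _ It)).
move=> H; apply: (is_derive_eq H) => /=.
have := gradient_unique cS cq (qb _ px) (dU _ cq) dUa.
rewrite dotrC [RHS]dotrC /covariant_acc !dotrE => e.
rewrite -[RHS](bracket _ px) e /=.
by rewrite [dotr (beta _) (q t)]dotrC (qb _ px); ring.
Qed.

End Mechanics.

(** * Differentials of functions on R^4 *)

Section DiffCalculus.
Context {R : realType} {V : normedModType R}.
Implicit Types (f g df dg L : V -> R) (x : V) (A : set V).

Lemma is_diff_fD f g df dg x : is_diff x f df -> is_diff x g dg ->
  is_diff x (fun y => f y + g y) (fun h => df h + dg h).
Proof. by move=> ? ?; exact: is_diffD. Qed.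

Lemma is_diff_fN f df x : is_diff x f df ->
  is_diff x (fun y => - f y) (fun h => - df h).
Proof. by move=> ?; exact: is_diffN. Qed.

Lemma is_diff_fM f g df dg x : is_diff x f df -> is_diff x g dg ->
  is_diff x (fun y => f y * g y) (fun h => f x * dg h + g x * df h).
Proof. by move=> ? ?; exact: is_diffM. Qed.

Lemma is_diff_fC c f df x : is_diff x f df ->
  is_diff x (fun y => c * f y) (fun h => c * df h).
Proof. by move=> ?; exact: is_diffZ. Qed.

Lemma is_diff_fX2 f df x : is_diff x f df ->
  is_diff x (fun y => f y ^+ 2) (fun h => 2 * f x * df h).
Proof.
move=> dF; apply: (is_diff_eq (is_diff_fM dF dF)).
by apply/funext => h; ring.
Qed.

Lemma is_diff_real_comp (phi : R -> R) d f df x :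
  is_diff x f df -> is_derive (f x) 1 phi d ->
  is_diff x (fun y => phi (f y)) (fun h => d * df h).
Proof.
move=> dF [dphi ephi].
have dphi' : is_diff (f x) phi (fun h => d * h).
  split; first exact/derivable1_diffP.
  rewrite (deriv1E dphi); apply/funext => h.
  by rewrite derive1E ephi /GRing.scale /= mulrC.
exact: is_diff_comp.
Qed.

Lemma is_diff_scalar L x : scalar L -> continuous L -> is_diff x L L.
Proof.
move=> sL cL.
pose LM := GRing.isLinear.Build _ _ _ _ _ sL.
pose LL : {linear V -> R} := HB.pack L LM.
split; first exact: (linear_differentiable (f := LL)).
exact: (diff_lin (f := LL)).
Qed.

Lemma eq_diff_on A f x L L' : (forall h, L h = L' h) -> is_diff_on A f x L ->
  is_diff_on A f x L'.
Proof. by move=> /funext ->. Qed.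

Lemma is_diff_onD A f g df dg x : is_diff_on A f x df -> is_diff_on A g x dg ->
  is_diff_on A (fun y => f y + g y) x (fun h => df h + dg h).
Proof.
move=> [sf df'] [sg dg']; split.
  by move=> c u v; rewrite sf sg /=; ring.
move=> e e0; have e2 : 0 < e / 2 by rewrite divr_gt0.
have := dg' _ e2; have := df' _ e2; apply: filterS2 => y hf hg.
rewrite (splitr e) mulrDl; apply: le_trans (lerD hf hg).
apply: le_trans (ler_normD _ _).
rewrite [X in _ <= `|X|](_ : _ = f y + g y - (f x + g x) - (df (y - x) + dg (y - x))) //.
by ring.
Qed.

Lemma is_diff_onN A f df x : is_diff_on A f x df ->
  is_diff_on A (fun y => - f y) x (fun h => - df h).
Proof.
move=> [sf dF]; split; first by move=> c u v; rewrite sf /=; ring.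
move=> e /dF; apply: filterS => y.
have -> : - f y - - f x - - df (y - x) = - (f y - f x - df (y - x)) by ring.
by rewrite normrN.
Qed.

Lemma is_diff_on0 A x : is_diff_on A (fun=> 0 : R) x (fun=> 0).
Proof. by apply: is_diff_on_ex; exact: is_diff_cst. Qed.

End DiffCalculus.

Lemma is_diff_on_fst (R : realType) n (Sing : set 'rV[R]_n.+1) U
    (x : 'rV[R]_n.+1 * 'rV[R]_n.+1) L :
  is_diff_on (config Sing) U x.1 L ->
  is_diff_on (phase Sing) (fun y => U y.1) x (fun xi => L xi.1).
Proof.
move=> [sL dU]; split; first by move=> c u v; rewrite -sL.
move=> e e0; have := dU _ e0; rewrite !near_withinE => H.
have c1 : {for x, continuous (fst : 'rV[R]_n.+1 * 'rV[R]_n.+1 -> _)} by exact: cvg_fst.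
have := c1 _ H; rewrite nbhs_simpl /=; apply: filterS => y h [cy _].
apply: (le_trans (h cy)); rewrite ler_pM2l //.
(* The norm of a pair is the maximum of the two norms. *)
by rewrite [leRHS]prod_normE le_max lexx.
Qed.

Section Row4.
Context {R : realType}.
Implicit Types (u v : 'rV[R]_4).

Lemma crd_row4 (x1 x2 x3 x4 : R) :
  (crd 1 (row4 x1 x2 x3 x4) = x1) * (crd 2 (row4 x1 x2 x3 x4) = x2) *
  (crd 3 (row4 x1 x2 x3 x4) = x3) * (crd 4 (row4 x1 x2 x3 x4) = x4).
Proof. by rewrite /crd /row4 !mxE !inordK. Qed.

Lemma dotr4 u v : dotr u v =
  crd 1 u * crd 1 v + crd 2 u * crd 2 v + crd 3 u * crd 3 v + crd 4 u * crd 4 v.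
Proof.
rewrite /dotr !big_ord_recl big_ord0 addr0 !addrA /crd /=.
have e0 : inord 0 = ord0 :> 'I_4 by apply/val_inj; rewrite /= inordK.
have e1 : inord 1 = lift ord0 ord0 :> 'I_4 by apply/val_inj; rewrite /= inordK.
have e2 : inord 2 = lift ord0 (lift ord0 ord0) :> 'I_4.
  by apply/val_inj; rewrite /= inordK.
have e3 : inord 3 = lift ord0 (lift ord0 (lift ord0 ord0)) :> 'I_4.
  by apply/val_inj; rewrite /= inordK.
by rewrite e0 e1 e2 e3.
Qed.

Lemma row4P u v : crd 1 u = crd 1 v -> crd 2 u = crd 2 v -> crd 3 u = crd 3 v ->
  crd 4 u = crd 4 v -> u = v.
Proof.
move=> e1 e2 e3 e4; apply/rowP => -[[|[|[|[|//]]]] ki].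
- by move: e1; rewrite /crd (_ : inord _ = Ordinal ki) //; apply/val_inj; rewrite /= inordK.
- by move: e2; rewrite /crd (_ : inord _ = Ordinal ki) //; apply/val_inj; rewrite /= inordK.
- by move: e3; rewrite /crd (_ : inord _ = Ordinal ki) //; apply/val_inj; rewrite /= inordK.
- by move: e4; rewrite /crd (_ : inord _ = Ordinal ki) //; apply/val_inj; rewrite /= inordK.
Qed.

Lemma crdD k u v : crd k (u + v) = crd k u + crd k v. Proof. by rewrite /crd mxE. Qed.
Lemma crdN k u : crd k (- u) = - crd k u. Proof. by rewrite /crd mxE. Qed.
Lemma crdZ k c u : crd k (c *: u) = c * crd k u. Proof. by rewrite /crd mxE. Qed.
Lemma crd0 k : crd k (0 : 'rV[R]_4) = 0. Proof. by rewrite /crd mxE. Qed.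

Definition crdE := (crdD, crdN, crdZ, crd0, crd_row4).

Lemma continuous_crd k : continuous (crd k : 'rV[R]_4 -> R).
Proof. by move=> v; exact: coord_continuous. Qed.

Lemma is_diff_crd k u : is_diff u (crd k : 'rV[R]_4 -> R) (crd k).
Proof. by apply: is_diff_scalar (@continuous_crd k) => c v w; rewrite !crdE. Qed.

Lemma is_diff_crd_fst k (x : 'rV[R]_4 * 'rV[R]_4) :
  is_diff x (fun y => crd k y.1) (fun xi => crd k xi.1).
Proof.
apply: is_diff_scalar => [c v w|v]; first by rewrite /= !crdE.
by apply: (@continuous_comp _ _ _ fst (crd k)); [exact: cvg_fst|exact: continuous_crd].
Qed.

Lemma is_diff_crd_snd k (x : 'rV[R]_4 * 'rV[R]_4) :
  is_diff x (fun y => crd k y.2) (fun xi => crd k xi.2).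
Proof.
apply: is_diff_scalar => [c v w|v]; first by rewrite /= !crdE.
by apply: (@continuous_comp _ _ _ snd (crd k)); [exact: cvg_snd|exact: continuous_crd].
Qed.

End Row4.

(** * Centers and angles *)

Section Centers.
Context {R : realType}.
Implicit Types (a c : R) (q : 'rV[R]_4).

Lemma sqr_le1_bound c : 0 <= 1 - c ^+ 2 -> -1 <= c <= 1.
Proof. by move=> h; apply/andP; split; nra. Qed.

Lemma sqrt1D2_gt0 a : 0 < Num.sqrt (1 + a ^+ 2).
Proof. by rewrite sqrtr_gt0 ltr_wpDr // sqr_ge0. Qed.

Lemma sqr_sqrt1D2 a : Num.sqrt (1 + a ^+ 2) ^+ 2 = 1 + a ^+ 2.
Proof. by rewrite sqr_sqrtr // addr_ge0 // sqr_ge0. Qed.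

Lemma sphere4 q : sphere q ->
  crd 1 q ^+ 2 + crd 2 q ^+ 2 + crd 3 q ^+ 2 + crd 4 q ^+ 2 = 1.
Proof. by rewrite /sphere /= dotr4 -!expr2. Qed.

(** Lets every computation for the first center serve for the second, with the opposite
    parameter. *)
Lemma Z2E a : Z2 a = Z1 (- a).
Proof. by rewrite /Z1 /Z2 sqrrN mulNr. Qed.

Lemma dotr_Z1 a q : dotr q (Z1 a) = (a * crd 1 q - crd 4 q) / Num.sqrt (1 + a ^+ 2).
Proof. by rewrite dotr4 /Z1 !crd_row4; ring. Qed.

(** Pythagoras: the right side is the squared length of the part of [q] orthogonal to [Z1 a], whose
    component in the (q1, q4) plane is along (1, a). This is the radicand in [Ehat_sp]. *)
Lemma sqr_sin_theta a q : sphere q -> 1 - dotr q (Z1 a) ^+ 2 =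
  (crd 1 q + a * crd 4 q) ^+ 2 / (1 + a ^+ 2) + crd 2 q ^+ 2 + crd 3 q ^+ 2.
Proof.
move=> /sphere4 sq; rewrite dotr_Z1.
have s0 := lt0r_neq0 (sqrt1D2_gt0 a); have ss := sqr_sqrt1D2 a.
move: (Num.sqrt _) s0 ss => s s0 ss; rewrite -ss.
apply: (mulIf (expf_neq0 2 s0)).
have -> : ((crd 1 q + a * crd 4 q) ^+ 2 / s ^+ 2 + crd 2 q ^+ 2 + crd 3 q ^+ 2) * s ^+ 2
  = (crd 1 q + a * crd 4 q) ^+ 2 + (crd 2 q ^+ 2 + crd 3 q ^+ 2) * s ^+ 2 by field.
have -> : (1 - ((a * crd 1 q - crd 4 q) / s) ^+ 2) * s ^+ 2
  = s ^+ 2 - (a * crd 1 q - crd 4 q) ^+ 2 by field.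
have -> : crd 2 q ^+ 2 + crd 3 q ^+ 2 = 1 - crd 1 q ^+ 2 - crd 4 q ^+ 2 by lra.
by rewrite ss; ring.
Qed.

Lemma sqr_sin_theta_ge0 a q : sphere q -> 0 <= 1 - dotr q (Z1 a) ^+ 2.
Proof.
move=> /(sqr_sin_theta a) ->; rewrite !addr_ge0 ?sqr_ge0 // divr_ge0 ?sqr_ge0 //.
by rewrite addr_ge0 // sqr_ge0.
Qed.

Lemma dotr_Z1_bound a q : sphere q -> -1 <= dotr q (Z1 a) <= 1.
Proof. by move=> /(sqr_sin_theta_ge0 a); exact: sqr_le1_bound. Qed.

(** If the sum of squares of [sqr_sin_theta] vanishes, [q] is on the line of [Z1 a], which meets the
    sphere only in the center and its antipode. *)
Lemma sqr_sin_theta_gt0 a q : sphere q -> q <> Z1 a -> q <> - Z1 a ->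
  0 < 1 - dotr q (Z1 a) ^+ 2.
Proof.
move=> sq n1 n2; rewrite lt0r sqr_sin_theta_ge0 // andbT.
apply/negP => /eqP; rewrite sqr_sin_theta // => D0.
have s2 : 0 < 1 + a ^+ 2 by rewrite ltr_wpDr // sqr_ge0.
have p1 : 0 <= (crd 1 q + a * crd 4 q) ^+ 2 / (1 + a ^+ 2).
  by rewrite divr_ge0 ?sqr_ge0 // ltW.
have q2 : crd 2 q = 0.
  by apply/eqP; rewrite -sqrf_eq0; apply/eqP; have := sqr_ge0 (crd 2 q); have := sqr_ge0 (crd 3 q); lra.
have q3 : crd 3 q = 0.
  by apply/eqP; rewrite -sqrf_eq0; apply/eqP; have := sqr_ge0 (crd 2 q); have := sqr_ge0 (crd 3 q); lra.
have q1 : crd 1 q = - a * crd 4 q.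
  move: D0; rewrite q2 q3 expr0n !addr0 => /eqP.
  by rewrite mulf_eq0 invr_eq0 (gt_eqF s2) orbF sqrf_eq0 addr_eq0 mulNr => /eqP.
have s0 := lt0r_neq0 (sqrt1D2_gt0 a).
have q4 : (crd 4 q * Num.sqrt (1 + a ^+ 2)) ^+ 2 = 1.
  by rewrite exprMn sqr_sqrt1D2 -[RHS](sphere4 sq) q1 q2 q3; ring.
have /orP[/eqP q4' | /eqP q4'] : (crd 4 q * Num.sqrt (1 + a ^+ 2) == 1) ||
    (crd 4 q * Num.sqrt (1 + a ^+ 2) == -1).
  by rewrite -sqrf_eq1 q4.
- have e4 : crd 4 q = 1 / Num.sqrt (1 + a ^+ 2) by apply: (mulIf s0); rewrite q4' divfK.
  by apply: n2; apply: row4P; rewrite /Z1 !crdE ?q1 ?q2 ?q3 ?e4; ring.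
- have e4 : crd 4 q = - (1 / Num.sqrt (1 + a ^+ 2)).
    by apply: (mulIf s0); rewrite q4' mulNr divfK.
  by apply: n1; apply: row4P; rewrite /Z1 !crdE ?q1 ?q2 ?q3 ?e4; ring.
Qed.

(** Turns the Kepler potential into a function of one linear form, a formula that also makes sense
    off the sphere. *)
Lemma cot_theta a q : sphere q -> cot (theta (Z1 a) q) =
  dotr q (Z1 a) * (Num.sqrt (1 - dotr q (Z1 a) ^+ 2))^-1.
Proof.
move=> sq; have b := dotr_Z1_bound a sq.
by rewrite /cot /theta sin_acos // acosK.
Qed.

Lemma sqr_tan_theta q : sphere q ->
  tan (theta (Z0 R) q) ^+ 2 = (1 - crd 4 q ^+ 2) * (crd 4 q ^+ 2)^-1.
Proof.
move=> sq; have e : dotr q (Z0 R) = - crd 4 q by rewrite dotr4 /Z0 !crdE; ring.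
have c0 : 0 <= 1 - crd 4 q ^+ 2.
  by rewrite -(sphere4 sq) addrK !addr_ge0 // sqr_ge0.
have b : -1 <= dotr q (Z0 R) <= 1.
  by apply: sqr_le1_bound; rewrite e sqrrN.
rewrite /tan /theta sin_acos // acosK // e sqrrN expr_div_n sqrrN sqr_sqrtr //.
Qed.

Lemma is_derive_inv_sin c : 0 < 1 - c ^+ 2 ->
  is_derive c 1 (fun y => (Num.sqrt (1 - y ^+ 2))^-1)
    (c * (Num.sqrt (1 - c ^+ 2)) ^- 3).
Proof.
move=> c0; pose D (y : R) := 1 - y ^+ 2; have c0' : 0 < D c by [].
have r0 : Num.sqrt (D c) != 0 by rewrite gt_eqF // sqrtr_gt0.
have dD : is_derive c 1 D (- 2 * c).
  by apply: is_derive_eq; rewrite /GRing.scale /=; ring.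
have ds := is_derive1_comp (is_derive1_sqrt c0') dD.
have H := @is_deriveV R (Num.sqrt \o D) c _ 1 r0 ds. 
apply: (is_derive_eq H).
by rewrite /GRing.scale /= -/(D c); field.
Qed.

Lemma is_derive_cot_acos c : 0 < 1 - c ^+ 2 ->
  is_derive c 1 (fun y => y * (Num.sqrt (1 - y ^+ 2))^-1)
    ((Num.sqrt (1 - c ^+ 2)) ^- 3).
Proof.
move=> c0.
have r0 : Num.sqrt (1 - c ^+ 2) != 0 by rewrite gt_eqF // sqrtr_gt0.
have rr : Num.sqrt (1 - c ^+ 2) ^+ 2 = 1 - c ^+ 2 by rewrite sqr_sqrtr // ltW.
apply: (is_derive_eq (is_deriveM (is_derive_id c (1 : R)) (is_derive_inv_sin c0))).
rewrite /GRing.scale /= mulr1.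
move: (Num.sqrt _) r0 rr => r r0 rr; apply: (mulfI (expf_neq0 3 r0)).
rewrite mulfV ?expf_neq0 // -[RHS](subrK (c ^+ 2)) -rr; field.
by [].
Qed.

End Centers.

(** * Potentials *)

Section Potentials.
Context {R : realType}.
Implicit Types (a c m f : R) (q : 'rV[R]_4) (A : set 'rV[R]_4).

Definition sin_theta a q := Num.sqrt (1 - dotr q (Z1 a) ^+ 2).

(** The scalar is [m] times the derivative of c / sqrt(1 - c^2) at c = q.Z1. The gradient is ambient
    and need not be tangent to the sphere. *)
Definition kepler_grad a m q : 'rV[R]_4 := (m * sin_theta a q ^- 3) *: Z1 a.

(** The share of one center in the position part of [Ehat_sp]; the other center has its share at
    [- a]. *)
Definition kepler_dual a m q : R := m * crd 4 q /
  Num.sqrt ((crd 1 q + a * crd 4 q) ^+ 2 / (1 + a ^+ 2) + crd 2 q ^+ 2 + crd 3 q ^+ 2).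

Definition kepler_dual_grad a m q : 'rV[R]_4 :=
  (m * (sin_theta a q)^-1) *: row4 0 0 0 1 +
  (m * crd 4 q * (dotr q (Z1 a) * sin_theta a q ^- 3)) *: Z1 a.

(** On the sphere the Hooke force function is f / q4^2 - f, differentiated here in the ambient
    space. *)
Definition hooke_grad f q : 'rV[R]_4 := row4 0 0 0 (- 2 * f / crd 4 q ^+ 3).

Definition hooke_dual a f q : R := f * (crd 1 q ^+ 2 / ((1 + a ^+ 2) * crd 4 q ^+ 2) +
  (crd 2 q ^+ 2 + crd 3 q ^+ 2) / crd 4 q ^+ 2).

Definition hooke_dual_grad a f q : 'rV[R]_4 := (2 * f / crd 4 q ^+ 2) *:
  row4 (crd 1 q / (1 + a ^+ 2)) (crd 2 q) (crd 3 q)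
    (- (crd 1 q ^+ 2 / (1 + a ^+ 2) + crd 2 q ^+ 2 + crd 3 q ^+ 2) / crd 4 q).

Lemma is_diff_dotr u q : is_diff q (fun y => dotr y u) (dotr u).
Proof.
rewrite (_ : (fun y => _) = dotr u); last by apply/funext => y; rewrite dotrC.
by apply: is_diff_scalar (@continuous_dotr _ _ u) => c v w; rewrite !dotrE.
Qed.

Lemma sin_theta_gt0 a q : sphere q -> q <> Z1 a -> q <> - Z1 a -> 0 < sin_theta a q.
Proof. by move=> sq n1 n2; rewrite sqrtr_gt0 sqr_sin_theta_gt0. Qed.

Lemma is_diff_kepler A a m q : A `<=` sphere (n := 3) -> A q ->
  (m != 0 -> q <> Z1 a /\ q <> - Z1 a) ->
  is_diff_on A (fun y => m * cot (theta (Z1 a) y)) q (dotr (kepler_grad a m q)).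
Proof.
(* A center without mass is not singular, so [q] may lie on it; the function is then identically
   0. *)
move=> As Aq; have [-> _|m0 /(_ isT)[n1 n2]] := eqVneq m 0.
  apply: (eq_is_diff_on (F := fun=> 0)) => // [y _|]; first by rewrite mul0r.
  apply: eq_diff_on (is_diff_on0 A q) => h.
  by rewrite /kepler_grad mul0r scale0r dotrC dotr0.
apply: (eq_is_diff_on (F := fun y => m *
    (dotr y (Z1 a) * (Num.sqrt (1 - dotr y (Z1 a) ^+ 2))^-1))) => // [y|].
  by rewrite inE => /As sy; rewrite cot_theta.
have D0 := sqr_sin_theta_gt0 (As _ Aq) n1 n2.
have := is_diff_fC m (is_diff_real_comp (is_diff_dotr (Z1 a) q) (is_derive_cot_acos D0)).
move=> /(is_diff_on_ex A); apply: eq_diff_on => h.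
by rewrite /kepler_grad dotrZl mulrA.
Qed.

Lemma is_diff_kepler_dual A a m q : A `<=` sphere (n := 3) -> A q ->
  (m != 0 -> q <> Z1 a /\ q <> - Z1 a) ->
  is_diff_on A (kepler_dual a m) q (dotr (kepler_dual_grad a m q)).
Proof.
move=> As Aq; have [-> _|m0 /(_ isT)[n1 n2]] := eqVneq m 0.
  apply: (eq_is_diff_on (F := fun=> 0)) => // [y _|]; first by rewrite /kepler_dual !mul0r.
  apply: eq_diff_on (is_diff_on0 A q) => h.
  by rewrite /kepler_dual_grad !mul0r !scale0r addr0 dotrC dotr0.
apply: (eq_is_diff_on (F := fun y => m * (crd 4 y *
    (Num.sqrt (1 - dotr y (Z1 a) ^+ 2))^-1))) => // [y|].
  by rewrite inE => /As sy; rewrite /kepler_dual -sqr_sin_theta // mulrA.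
have D0 := sqr_sin_theta_gt0 (As _ Aq) n1 n2.
have := is_diff_fC m (is_diff_fM (is_diff_crd 4 q)
  (is_diff_real_comp (is_diff_dotr (Z1 a) q) (is_derive_inv_sin D0))).
move=> /(is_diff_on_ex A); apply: eq_diff_on => h.
rewrite /kepler_dual_grad !dotrE /sin_theta.
rewrite (_ : dotr (row4 0 0 0 1) h = crd 4 h); last by rewrite dotr4 !crdE; ring.
by ring.
Qed.

Lemma is_derive_inv_sqr c : c != 0 -> is_derive c 1 (fun y : R => (y ^+ 2)^-1) (- 2 / c ^+ 3).
Proof.
move=> c0.
have d2 : is_derive c 1 (fun y : R => y ^+ 2) (2 * c).
  by apply: is_derive_eq; rewrite /GRing.scale /=; ring.
have H := @is_deriveV R (fun y : R => y ^+ 2) c _ 1 (expf_neq0 2 c0) d2.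
by apply: (is_derive_eq H); rewrite /GRing.scale /=; field.
Qed.

Lemma is_diff_hooke A f q : A `<=` sphere (n := 3) -> A q ->
  (f != 0 -> crd 4 q != 0) ->
  is_diff_on A (fun y => f * tan (theta (Z0 R) y) ^+ 2) q (dotr (hooke_grad f q)).
Proof.
move=> As Aq; have [-> _|f0 /(_ isT) q40] := eqVneq f 0.
  apply: (eq_is_diff_on (F := fun=> 0)) => // [y _|]; first by rewrite mul0r.
  apply: eq_diff_on (is_diff_on0 A q) => h.
  by rewrite /hooke_grad dotr4 !crdE mulr0 !mul0r !addr0.
apply: (eq_is_diff_on (F := fun y => f * ((1 + (- 1) * crd 4 y ^+ 2) *
    (crd 4 y ^+ 2)^-1))) => // [y|].
  by rewrite inE => /As sy; rewrite sqr_tan_theta // mulN1r.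
have := is_diff_fC f (is_diff_fM (is_diff_fD (is_diff_cst (1 : R^o) q)
  (is_diff_fC (-1) (is_diff_fX2 (is_diff_crd 4 q))))
  (is_diff_real_comp (is_diff_crd 4 q) (is_derive_inv_sqr q40))).
move=> /(is_diff_on_ex A); apply: eq_diff_on => h.
rewrite /hooke_grad dotr4 !crdE /= (_ : (0 : _ -> R) h = 0) //; by field.
Qed.

Lemma is_diff_hooke_dual A a f q : A q -> (f != 0 -> crd 4 q != 0) ->
  is_diff_on A (hooke_dual a f) q (dotr (hooke_dual_grad a f q)).
Proof.
move=> Aq; have [-> _|f0 /(_ isT) q40] := eqVneq f 0.
  apply: (eq_is_diff_on (F := fun=> 0)) => // [y _|]; first by rewrite /hooke_dual !mul0r.
  apply: eq_diff_on (is_diff_on0 A q) => h.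
  by rewrite /hooke_dual_grad mulr0 mul0r scale0r dotrC dotr0.
have s0 : 1 + a ^+ 2 != 0 by rewrite gt_eqF // ltr_wpDr // sqr_ge0.
apply: (eq_is_diff_on (F := fun y => f * (((1 + a ^+ 2)^-1 * crd 1 y ^+ 2 +
    (crd 2 y ^+ 2 + crd 3 y ^+ 2)) * (crd 4 y ^+ 2)^-1))) => // [y _|].
  by rewrite /hooke_dual [((1 + _) * _)^-1]invfM; ring.
have := is_diff_fC f (is_diff_fM (is_diff_fD
    (is_diff_fC ((1 + a ^+ 2)^-1) (is_diff_fX2 (is_diff_crd 1 q)))
    (is_diff_fD (is_diff_fX2 (is_diff_crd 2 q)) (is_diff_fX2 (is_diff_crd 3 q))))
  (is_diff_real_comp (is_diff_crd 4 q) (is_derive_inv_sqr q40))).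
move=> /(is_diff_on_ex A); apply: eq_diff_on => h.
by rewrite /hooke_dual_grad dotr4 !crdE /=; field; rewrite q40 s0.
Qed.

End Potentials.

(** * First integrals and involution *)

Section Integrals.
Context {R : realType}.
Variables (a mh1 mh2 f : R).
Implicit Types (q v : 'rV[R]_4) (x : 'rV[R]_4 * 'rV[R]_4).

Local Notation Sing := (lagrange_sing a mh1 mh2 f).

(* The partial gradient in v of the kinetic part of Ehat_sp; since that part
   is invariant under exchanging q and v, so is its gradient up to this swap. *)
Definition dual_momentum (b : R) q v : 'rV[R]_4 :=
  let w1 := (crd 4 q * crd 1 v - crd 1 q * crd 4 v) / (1 + b ^+ 2) in
  let w2 := crd 4 q * crd 2 v - crd 2 q * crd 4 v in
  let w3 := crd 4 q * crd 3 v - crd 3 q * crd 4 v in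
  row4 (crd 4 q * w1) (crd 4 q * w2) (crd 4 q * w3)
    (- (crd 1 q * w1 + crd 2 q * w2 + crd 3 q * w3)).

(** Up to the factor m / (s r^3), with s = sqrt(1 + b^2) and r the sine of the angle, the left side
    is q4 (q.v), which tangency kills. *)
Lemma kepler_dual_bracket (b m : R) q v : sphere q -> dotr q v = 0 ->
  (m != 0 -> q <> Z1 b /\ q <> - Z1 b) ->
  dotr (kepler_grad b m q) (dual_momentum b q v) +
  dotr (kepler_dual_grad b (m / Num.sqrt (1 + b ^+ 2)) q) v = 0.
Proof.
move=> sq qv; have [-> _|m0 /(_ isT)[n1 n2]] := eqVneq m 0.
  by rewrite /kepler_grad /kepler_dual_grad !mul0r !scale0r addr0 ![dotr 0 _]dotrC !dotr0 addr0.
have r0 := lt0r_neq0 (sin_theta_gt0 sq n1 n2).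
have rr : sin_theta b q ^+ 2 =
    (crd 1 q + b * crd 4 q) ^+ 2 / (1 + b ^+ 2) + crd 2 q ^+ 2 + crd 3 q ^+ 2.
  by rewrite -sqr_sin_theta // sqr_sqrtr // sqr_sin_theta_ge0.
have S0 : 1 + b ^+ 2 != 0 by rewrite gt_eqF // ltr_wpDr // sqr_ge0.
have s0 := lt0r_neq0 (sqrt1D2_gt0 b); have ss := sqr_sqrt1D2 b.
have e4 : dotr (row4 0 0 0 1) v = crd 4 v by rewrite dotr4 !crdE; ring.
rewrite /kepler_grad /kepler_dual_grad !dotrE e4 !(dotrC (Z1 b)) !dotr_Z1 /dual_momentum !crdE.
move: (sin_theta b q) r0 rr => r r0 rr.
move: (Num.sqrt _) s0 ss => s s0 ss.
rewrite [LHS](_ : _ = m / s * r ^- 3 * (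
  b * (crd 4 q * ((crd 4 q * crd 1 v - crd 1 q * crd 4 v) / (1 + b ^+ 2))) +
  (crd 1 q * ((crd 4 q * crd 1 v - crd 1 q * crd 4 v) / (1 + b ^+ 2)) +
   crd 2 q * (crd 4 q * crd 2 v - crd 2 q * crd 4 v) +
   crd 3 q * (crd 4 q * crd 3 v - crd 3 q * crd 4 v)) +
   r ^+ 2 * crd 4 v + crd 4 q * (b * crd 1 q - crd 4 q) * (b * crd 1 v - crd 4 v) / s ^+ 2));
  last by field; rewrite s0 r0 S0.
rewrite rr ss [X in _ * X](_ : _ = crd 4 q * dotr q v); first by rewrite qv !mulr0.
by rewrite dotr4; field.
Qed.

(** With w as in [dual_momentum], both products equal (2 m / q4^3) (q1 w1 + q2 w2 + q3 w3). *)
Lemma hooke_dual_bracket (b m : R) q v : (m != 0 -> crd 4 q != 0) ->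
  dotr (hooke_grad m q) (dual_momentum b q v) - dotr (hooke_dual_grad b m q) v = 0.
Proof.
have [-> _|m0 /(_ isT) q40] := eqVneq m 0.
  by rewrite !dotr4 /hooke_dual_grad /dual_momentum !crdE; ring.
have S0 : 1 + b ^+ 2 != 0 by rewrite gt_eqF // ltr_wpDr // sqr_ge0.
by rewrite !dotr4 /hooke_dual_grad /dual_momentum !crdE; field; rewrite q40 S0.
Qed.

Definition lagrange_grad q := kepler_grad a mh1 q + kepler_grad (- a) mh2 q + hooke_grad f q.

Definition lagrange_dual_grad q :=
  kepler_dual_grad a (mh1 / Num.sqrt (1 + a ^+ 2)) q +
  kepler_dual_grad (- a) (mh2 / Num.sqrt (1 + a ^+ 2)) q - hooke_dual_grad a f q.

Lemma lagrange_singP q : config Sing q ->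
  [/\ sphere q, mh1 != 0 -> q <> Z1 a /\ q <> - Z1 a,
      mh2 != 0 -> q <> Z1 (- a) /\ q <> - Z1 (- a) & f != 0 -> crd 4 q != 0].
Proof.
rewrite -Z2E => -[sq nS]; split=> // [m0|m0|f0].
- by split=> qZ; apply: nS; apply: Or31; split=> //; [left|right].
- by split=> qZ; apply: nS; apply: Or32; split=> //; [left|right].
- by apply/negP => /eqP q4; apply: nS; apply: Or33; split.
Qed.

Lemma closed_lagrange_sing : closed Sing.
Proof.
(* The conditions on the masses do not depend on the point, so each piece of the singular set is
   either a fixed closed set or empty. *)
have cP (P : Prop) (A : set 'rV[R]_4) : closed A -> closed [set q | P /\ A q].
  move=> cA; have [p|np] := pselect P.
    by rewrite (_ : [set q | _] = A) //; apply/seteqP; split=> q //= [].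
  rewrite (_ : [set q | _] = set0); first exact: closed0.
  by apply/seteqP; split=> q //= [].
have c1 (p : 'rV[R]_4) : closed [set q | q = p].
  have := @accessible_closed_set1 'rV[R]_4 (hausdorff_accessible (@norm_hausdorff _ _)) p.
  by [].
have c4 : closed [set q : 'rV[R]_4 | crd 4 q = 0].
  apply: (closed_comp (f := crd 4) (D := [set 0])) => [q _|].
    exact: continuous_crd.
  exact: closed_eq.
rewrite (_ : Sing = [set q | mh1 != 0 /\ ([set q | q = Z1 a] `|` [set q | q = - Z1 a]) q] `|`
  [set q | mh2 != 0 /\ ([set q | q = Z2 a] `|` [set q | q = - Z2 a]) q] `|`
  [set q | f != 0 /\ [set q | crd 4 q = 0] q]).
  by do 2?apply: closedU; apply: cP => //; apply: closedU; exact: c1.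
apply/seteqP; split=> q.
  by case=> H; [left; left|left; right|right].
by case=> [[]|] H; [apply: Or31|apply: Or32|apply: Or33].
Qed.

Lemma is_diff_lagrange_force q : config Sing q ->
  is_diff_on (config Sing) (lagrange_force a mh1 mh2 f) q (dotr (lagrange_grad q)).
Proof.
move=> cq; have [sq h1 h2 h0] := lagrange_singP cq.
have cs : config Sing `<=` sphere (n := 3) by move=> y [].
have := is_diff_onD (is_diff_onD (is_diff_kepler cs cq h1) (is_diff_kepler cs cq h2))
  (is_diff_hooke cs cq h0).
rewrite -Z2E; apply: eq_diff_on => h.
by rewrite /lagrange_grad !dotrDl.
Qed.

(** The part of [Ehat_sp] that depends on the position alone. *)
Definition lagrange_dual q :=
  kepler_dual a (mh1 / Num.sqrt (1 + a ^+ 2)) q +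
  kepler_dual (- a) (mh2 / Num.sqrt (1 + a ^+ 2)) q - hooke_dual a f q.

Lemma is_diff_lagrange_dual q : config Sing q ->
  is_diff_on (config Sing) lagrange_dual q (dotr (lagrange_dual_grad q)).
Proof.
move=> cq; have [sq h1 h2 h0] := lagrange_singP cq.
have cs : config Sing `<=` sphere (n := 3) by move=> y [].
have m0 (m : R) : m / Num.sqrt (1 + a ^+ 2) != 0 -> m != 0.
  by apply: contra => /eqP ->; rewrite mul0r.
have hN : - f != 0 -> crd 4 q != 0 by rewrite oppr_eq0.
have := is_diff_onD (is_diff_onD
  (is_diff_kepler_dual cs cq (fun m1 => h1 (m0 _ m1)))
  (is_diff_kepler_dual cs cq (fun m2 => h2 (m0 _ m2))))
  (is_diff_hooke_dual a cq hN).
move=> H; apply: (eq_is_diff_on _ _ (eq_diff_on _ H)) => // [y _|h].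
  by rewrite /lagrange_dual /hooke_dual mulNr.
rewrite /lagrange_dual_grad !dotrE; congr (_ + _).
by rewrite mulrN !mulNr.
Qed.

(** Partial gradients in the position, in the order of [lagrange_integrals]; [lagrange_beta] lists
    those in the velocity. *)
Definition lagrange_alpha (i : nat) x : 'rV[R]_4 :=
  [:: - lagrange_grad x.1;
      dual_momentum a x.2 x.1 + lagrange_dual_grad x.1;
      row4 0 (- crd 3 x.2) (crd 2 x.2) 0]`_i.

Definition lagrange_beta (i : nat) x : 'rV[R]_4 :=
  [:: x.2; dual_momentum a x.1 x.2; row4 0 (crd 3 x.1) (- crd 2 x.1) 0]`_i.

Lemma lagrange_betaP (i : 'I_3) x : phase Sing x -> dotr x.1 (lagrange_beta i x) = 0.
Proof.
move=> [_ qv]; case: i => -[|[|[|//]]] ? //=; rewrite dotr4 /dual_momentum !crdE; ring.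
Qed.

Lemma gradient_E_sph x : phase Sing x ->
  has_gradient Sing (E_sph a mh1 mh2 f) x (lagrange_alpha 0 x) (lagrange_beta 0 x).
Proof.
move=> px; have [cq _] := px.
have := is_diff_on_fst (is_diff_lagrange_force cq).
have K : is_diff x (fun y : 'rV[R]_4 * 'rV[R]_4 => dotr y.2 y.2 / 2) (fun xi => dotr x.2 xi.2).
  rewrite (_ : (fun y => _) = fun y : 'rV[R]_4 * 'rV[R]_4 => 2^-1 *
    (crd 1 y.2 ^+ 2 + crd 2 y.2 ^+ 2 + crd 3 y.2 ^+ 2 + crd 4 y.2 ^+ 2)); last first.
    by apply/funext => y; rewrite dotr4 mulrC -!expr2.
  apply: is_diff_eq (is_diff_fC _ (is_diff_fD (is_diff_fD (is_diff_fD
    (is_diff_fX2 (is_diff_crd_snd 1 x)) (is_diff_fX2 (is_diff_crd_snd 2 x)))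
    (is_diff_fX2 (is_diff_crd_snd 3 x))) (is_diff_fX2 (is_diff_crd_snd 4 x)))) _.
  by apply/funext => h; rewrite dotr4; field.
move=> /is_diff_onN U.
apply: (eq_is_diff_on _ _ (eq_diff_on _ (is_diff_onD (is_diff_on_ex _ K) U))) => // [y _|h].
  by rewrite /E_sph /lagrange_force; ring.
by rewrite /lagrange_alpha /lagrange_beta /= dotrNl addrC.
Qed.

Lemma gradient_Ehat_sp x : phase Sing x ->
  has_gradient Sing (Ehat_sp a mh1 mh2 f) x (lagrange_alpha 1 x) (lagrange_beta 1 x).
Proof.
move=> px; have [cq _] := px.
have W := is_diff_on_fst (is_diff_lagrange_dual cq).
have w i := is_diff_fD (is_diff_fM (is_diff_crd_fst 4 x) (is_diff_crd_snd i x))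
  (is_diff_fC (-1) (is_diff_fM (is_diff_crd_fst i x) (is_diff_crd_snd 4 x))).
have K := is_diff_fD (is_diff_fD (is_diff_fC ((2 * (1 + a ^+ 2))^-1) (is_diff_fX2 (w 1%N)))
  (is_diff_fC (2^-1) (is_diff_fX2 (w 2%N)))) (is_diff_fC (2^-1) (is_diff_fX2 (w 3%N))).
have S0 : 1 + a ^+ 2 != 0 by rewrite gt_eqF // ltr_wpDr // sqr_ge0.
apply: (eq_is_diff_on _ _ (eq_diff_on _ (is_diff_onD (is_diff_on_ex _ K) W))) => // [y _|h].
  rewrite /Ehat_sp /lagrange_dual /kepler_dual /hooke_dual sqrrN !mulNr.
  ring.
rewrite /lagrange_alpha /lagrange_beta /=; move: (lagrange_dual_grad x.1) => g.
by rewrite !dotr4 /dual_momentum !crdE; field.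
Qed.

Lemma gradient_Lhat_yz x : phase Sing x ->
  has_gradient Sing (@Lhat_yz R) x (lagrange_alpha 2 x) (lagrange_beta 2 x).
Proof.
move=> px; apply: (eq_is_diff_on _ _ (eq_diff_on _ (is_diff_on_ex _ (is_diff_fD
  (is_diff_fM (is_diff_crd_fst 3 x) (is_diff_crd_snd 2 x))
  (is_diff_fC (-1) (is_diff_fM (is_diff_crd_fst 2 x) (is_diff_crd_snd 3 x))))))) => // [y _|h].
  by rewrite /Lhat_yz mulN1r.
by rewrite /lagrange_alpha /lagrange_beta /= !dotr4 !crdE; ring.
Qed.

Lemma gradient_lagrange_integrals (i : 'I_3) x : phase Sing x ->
  has_gradient Sing (tnth (lagrange_integrals a mh1 mh2 f) i) x
    (lagrange_alpha i x) (lagrange_beta i x).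
Proof.
move=> px; case: i => -[|[|[|//]]] ? /=; rewrite (tnth_nth (@Lhat_yz R)) /=.
- exact: gradient_E_sph.
- exact: gradient_Ehat_sp.
- exact: gradient_Lhat_yz.
Qed.

Lemma lagrange_bracket (i j : 'I_3) x : phase Sing x ->
  dotr (lagrange_alpha i x) (lagrange_beta j x) -
  dotr (lagrange_beta i x) (lagrange_alpha j x) = 0.
Proof.
move=> px; have [cq qv] := px; have [sq h1 h2 h0] := lagrange_singP cq.
(* Energy against [Ehat_sp]: the identities of the three centers add up, and the kinetic term
   vanishes because [dual_momentum a x.2 x.1] is orthogonal to [x.2]. *)
have b01 : dotr (lagrange_grad x.1) (dual_momentum a x.1 x.2) +
    dotr x.2 (dual_momentum a x.2 x.1 + lagrange_dual_grad x.1) = 0.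
  have := kepler_dual_bracket sq qv h1; have := kepler_dual_bracket sq qv h2.
  have -> : dual_momentum (- a) x.1 x.2 = dual_momentum a x.1 x.2.
    by rewrite /dual_momentum sqrrN.
  rewrite sqrrN.
  have := hooke_dual_bracket a x.2 h0.
  rewrite /lagrange_grad /lagrange_dual_grad !(dotrC x.2) !(dotrDl, dotrNl) => e0 e2 e1.
  have -> : dotr (dual_momentum a x.2 x.1) x.2 = 0.
    by rewrite dotr4 /dual_momentum !crdE; ring.
  by lra.
(* The force function is invariant under rotations of the (q2, q3) plane, since all centers are
   fixed by them. *)
have b02 : dotr (lagrange_grad x.1) (row4 0 (crd 3 x.1) (- crd 2 x.1) 0) = 0.
  by rewrite /lagrange_grad dotr4 /kepler_grad /hooke_grad !crdE; ring.
(* The same rotations, acting on position and velocity together, preserve [Ehat_sp]. *)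
have b12 : dotr (dual_momentum a x.2 x.1 + lagrange_dual_grad x.1)
    (row4 0 (crd 3 x.1) (- crd 2 x.1) 0) =
    dotr (dual_momentum a x.1 x.2) (row4 0 (- crd 3 x.2) (crd 2 x.2) 0).
  by rewrite /lagrange_dual_grad !dotr4 /kepler_dual_grad /hooke_dual_grad /dual_momentum !crdE; ring.
have b02' : dotr x.2 (row4 0 (- crd 3 x.2) (crd 2 x.2) 0) = 0.
  by rewrite dotr4 !crdE; ring.
case: i => -[|[|[|//]]] ?; case: j => -[|[|[|//]]] ?;
  rewrite /lagrange_alpha /lagrange_beta /= ?dotrNl ?dotrNr.
- by rewrite (dotrC x.2); ring.
- by move: b01; lra.
- by rewrite b02 b02'; ring.
- by rewrite (dotrC _ x.2) (dotrC _ (lagrange_grad _)); move: b01; lra.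
- by rewrite (dotrC (dual_momentum a x.1 x.2)); ring.
- by rewrite b12; ring.
- by rewrite (dotrC _ x.2) (dotrC _ (lagrange_grad _)) b02 b02'; ring.
- by rewrite (dotrC _ (dual_momentum a x.1 x.2)) -b12 (dotrC (row4 _ _ _ _) (_ + _)); ring.
- by rewrite !dotr4 !crdE; ring.
Qed.

Lemma lagrange_involution (i j : 'I_3) :
  in_involution Sing (tnth (lagrange_integrals a mh1 mh2 f) i)
    (tnth (lagrange_integrals a mh1 mh2 f) j).
Proof.
move=> x px; rewrite -(lagrange_bracket i j px) -[X in is_poisson _ _ _ _ (_ - X)]/(dotr _ _).
by apply: poisson_gradient => //; (exact: lagrange_betaP || exact: gradient_lagrange_integrals).
Qed.

Lemma lagrange_first_integral (i : 'I_3) :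
  first_integral (lagrange_force a mh1 mh2 f) Sing
    (tnth (lagrange_integrals a mh1 mh2 f) i).
Proof.
apply: (first_integral_gradient closed_lagrange_sing is_diff_lagrange_force
  (@gradient_lagrange_integrals i) (@lagrange_betaP i)) => x px.
(* Index 0 is the energy, with gradients minus that of the force and the velocity: this bracket is
   the time derivative. *)
rewrite -(lagrange_bracket i ord0 px) /lagrange_alpha /lagrange_beta /=.
by rewrite dotrNr opprK.
Qed.

End Integrals.

(** * Functional independence *)

Lemma poly_neq0_large (R : realType) (p : {poly R}) (M : R) : p != 0 ->
  exists2 s, M < s & p.[s] != 0.
Proof.
move=> p0; apply: contrapT => H.
(* These are [size p] distinct points beyond [M], one more than the degree, so they cannot all be
   roots. *)
pose rs := [seq M + i.+1%:R | i <- iota 0 (size p)].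
have := max_poly_roots p0 (rs := rs); rewrite size_map size_iota ltnn.
suff: all (root p) rs /\ uniq rs by case=> -> -> /(_ isT isT).
split.
  apply/allP => s /mapP[i _ ->]; apply/negPn/negP => r; apply: H.
  by exists (M + i.+1%:R) => //; rewrite ltrDl.
rewrite map_inj_uniq ?iota_uniq // => i j /addrI /eqP.
by rewrite eqr_nat eqSS => /eqP.
Qed.

Section Independence.
Context {R : realType}.
Variables (a mh1 mh2 f : R).
Implicit Types (q v : 'rV[R]_4) (x : 'rV[R]_4 * 'rV[R]_4).

Local Notation Sing := (lagrange_sing a mh1 mh2 f).

(* Up to the factor q4 (q2^2 + q3^2), this is the determinant of the components
   of dE and dEhat along the fibre in the directions q1 and (q2, q3). *)
Definition fibre_minor (S : comNzRingType) (k q1 q2 q3 q4 v1 v2 v3 v4 : S) : S :=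
  q4 * (q2 ^+ 2 + q3 ^+ 2) *
  (v1 * (q2 * (q4 * v2 - q2 * v4) + q3 * (q4 * v3 - q3 * v4)) -
   k * ((q2 * v2 + q3 * v3) * (q4 * v1 - q1 * v4))).

Definition minor x : R := fibre_minor (1 + a ^+ 2)^-1
  (crd 1 x.1) (crd 2 x.1) (crd 3 x.1) (crd 4 x.1)
  (crd 1 x.2) (crd 2 x.2) (crd 3 x.2) (crd 4 x.2).

Lemma continuous_minor : continuous minor.
Proof.
move=> x; apply: differentiable_continuous.
suff [df] : exists df, is_diff x minor df by case.
rewrite /minor /fibre_minor; eexists.
repeat first [exact: is_diff_crd_fst | exact: is_diff_crd_snd | apply: is_diff_fN |
  apply: is_diff_fD | apply: is_diff_fX2 | apply: is_diff_fC | apply: is_diff_fM].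
Qed.

Lemma open_minor : open [set x | minor x != 0].
Proof.
rewrite (_ : [set x | _] = minor @^-1` [set r | r != 0]) //.
apply: open_comp => [x _|]; [exact: continuous_minor|exact: open_neq].
Qed.

(** The first factors of the minor force q4 and (q2, q3) to be nonzero, so the point avoids the
    equator and every center, whatever the masses. *)
Lemma minor_config x : minor x != 0 -> sphere x.1 -> config Sing x.1.
Proof.
rewrite /minor /fibre_minor !mulf_eq0 !negb_or -!andbA => /and3P[q4 r2 _] sq; split=> //.
have nZ b : x.1 = Z1 b \/ x.1 = - Z1 b -> False.
  by move: r2 => /[swap] -[] ->; rewrite /Z1 !crdE ?oppr0 expr0n addr0 eqxx.
case=> -[_]; [exact: nZ|rewrite Z2E; exact: nZ|].
by move=> q40; rewrite q40 eqxx in q4.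
Qed.

Lemma minor_independent x : phase Sing x -> minor x != 0 ->
  independent_at Sing (lagrange_integrals a mh1 mh2 f) x.
Proof.
move=> px mx; have [[sq _] qv] := px.
exists (fun i xi => dotr (lagrange_alpha a mh1 mh2 f i x) xi.1 +
  dotr (lagrange_beta a i x) xi.2); split.
  by move=> i; exact: gradient_lagrange_integrals.
move=> c H.
pose c0 := c ord0; pose c1 := c (lift ord0 ord0); pose c2 := c (lift ord0 (lift ord0 ord0)).
(* The vanishing combination is tested on the vertical vector (0, u), where u is its own velocity
   gradient and is tangent; this gives u.u = 0. *)
pose u : 'rV[R]_4 := c0 *: x.2 + c1 *: dual_momentum a x.1 x.2 +
  c2 *: row4 0 (crd 3 x.1) (- crd 2 x.1) 0.
have uE w : dotr u w = \sum_(i < 3) c i * dotr (lagrange_beta a i x) w.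
  by rewrite /u !big_ord_recl !big_ord0 addr0 !dotrE addrA.
have qu : dotr x.1 u = 0.
  by rewrite dotrC uE big1 // => i _; rewrite dotrC (lagrange_betaP i px) mulr0.
have u0 : u = 0.
  apply: dotrr_eq0; rewrite uE -[RHS](H (0, u)).
    by apply: eq_bigr => i _; rewrite /= dotr0 add0r.
  by split; rewrite /= ?dotr0 // dotrC dotr0 add0r.
have {}u0 k : crd k u = 0 by rewrite u0 crd0.
move: (u0 1%N) (u0 2%N) (u0 3%N) => {u0 H uE qu}.
rewrite /u /dual_momentum !crdE.
move: mx; rewrite /minor /fibre_minor !mulf_eq0 !negb_or -!andbA => /and3P[].
set q4 := crd 4 x.1; set q3 := crd 3 x.1; set q2 := crd 2 x.1; set q1 := crd 1 x.1.
set v4 := crd 4 x.2; set v3 := crd 3 x.2; set v2 := crd 2 x.2; set v1 := crd 1 x.2.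
set w1 := q4 * v1 - q1 * v4; set w2 := q4 * v2 - q2 * v4; set w3 := q4 * v3 - q3 * v4.
set k := (1 + a ^+ 2)^-1.
move=> q40 r0 m0 e1 e2 e3.
(* The radial combination in the (q2, q3) plane eliminates c2. Cramer's rule with [e1] then yields
   c0 and c1, and the angular combination yields c2. *)
have er : c0 * (q2 * v2 + q3 * v3) + c1 * (q4 * (q2 * w2 + q3 * w3)) = 0.
  transitivity (q2 * (c0 * v2 + c1 * (q4 * w2) + c2 * q3) +
    q3 * (c0 * v3 + c1 * (q4 * w3) + c2 * - q2)); first by ring.
  by rewrite e2 e3 !mulr0 addr0.
have c00 : c0 = 0.
  apply: (mulIf m0); rewrite mul0r.
  transitivity ((q2 * w2 + q3 * w3) * (c0 * v1 + c1 * (q4 * (w1 * k)) + c2 * 0) -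
    k * w1 * (c0 * (q2 * v2 + q3 * v3) + c1 * (q4 * (q2 * w2 + q3 * w3)))); first by ring.
  by rewrite e1 er; ring.
have c10 : c1 = 0.
  apply: (mulIf (mulf_neq0 q40 m0)); rewrite mul0r.
  transitivity (v1 * (c0 * (q2 * v2 + q3 * v3) + c1 * (q4 * (q2 * w2 + q3 * w3))) -
    (q2 * v2 + q3 * v3) * (c0 * v1 + c1 * (q4 * (w1 * k)) + c2 * 0)); first by ring.
  by rewrite e1 er; ring.
have c20 : c2 = 0.
  apply: (mulIf r0); rewrite mul0r.
  transitivity (q3 * (c0 * v2 + c1 * (q4 * w2) + c2 * q3) -
    q2 * (c0 * v3 + c1 * (q4 * w3) + c2 * - q2)); first by rewrite c00 c10; ring.
  by rewrite e2 e3; ring.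
case=> -[|[|[|//]]] ki.
- by rewrite -[RHS]c00; congr c; apply/val_inj.
- by rewrite -[RHS]c10; congr c; apply/val_inj.
- by rewrite -[RHS]c20; congr c; apply/val_inj.
Qed.

Lemma fibre_minorZ (k l m q1 q2 q3 q4 v1 v2 v3 v4 : R) :
  fibre_minor k (l * q1) (l * q2) (l * q3) (l * q4) (m * v1) (m * v2) (m * v3) (m * v4) =
  l ^+ 5 * m ^+ 2 * fibre_minor k q1 q2 q3 q4 v1 v2 v3 v4.
Proof. by rewrite /fibre_minor; ring. Qed.

(* The minor at (q, v) made into a point of the phase space by normalizing q and
   projecting v, up to a positive factor: N and D are q.q and q.v. *)
Definition line_minor (S : comNzRingType) (k q1 q2 q3 q4 v1 v2 v3 v4 : S) : S :=
  let N := q1 * q1 + q2 * q2 + q3 * q3 + q4 * q4 in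
  let D := q1 * v1 + q2 * v2 + q3 * v3 + q4 * v4 in
  fibre_minor k q1 q2 q3 q4 (N * v1 - D * q1) (N * v2 - D * q2)
    (N * v3 - D * q3) (N * v4 - D * q4).

Lemma line_minorZ (k l q1 q2 q3 q4 v1 v2 v3 v4 : R) :
  line_minor k (l * q1) (l * q2) (l * q3) (l * q4) (l * v1) (l * v2) (l * v3) (l * v4) =
  l ^+ 11 * line_minor k q1 q2 q3 q4 v1 v2 v3 v4.
Proof. by rewrite /line_minor /fibre_minor; ring. Qed.

(** The minors are defined over any commutative ring so that the same expression can be formed with
    polynomials and then evaluated. *)
Lemma horner_fibre_minor (k q1 q2 q3 q4 v1 v2 v3 v4 : {poly R}) (s : R) :
  (fibre_minor k q1 q2 q3 q4 v1 v2 v3 v4).[s] =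
  fibre_minor k.[s] q1.[s] q2.[s] q3.[s] q4.[s] v1.[s] v2.[s] v3.[s] v4.[s].
Proof. by rewrite /fibre_minor !(hornerM, hornerD, hornerN, horner_exp). Qed.

Lemma horner_line_minor (k q1 q2 q3 q4 v1 v2 v3 v4 : {poly R}) (s : R) :
  (line_minor k q1 q2 q3 q4 v1 v2 v3 v4).[s] =
  line_minor k.[s] q1.[s] q2.[s] q3.[s] q4.[s] v1.[s] v2.[s] v3.[s] v4.[s].
Proof.
by rewrite /line_minor horner_fibre_minor !(hornerM, hornerD, hornerN).
Qed.

(** With s = 1/e these are the points (q, v) + e ((1, 1, 0, 1), (1, 0, 0, 0)) multiplied by s, so a
    large [s] means a point close to (q, v). *)
Lemma line_minor_nearby q v M : exists2 s, M < s &
  line_minor (1 + a ^+ 2)^-1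
    (1 + s * crd 1 q) (1 + s * crd 2 q) (s * crd 3 q) (1 + s * crd 4 q)
    (1 + s * crd 1 v) (s * crd 2 v) (s * crd 3 v) (s * crd 4 v) != 0.
Proof.
pose k := (1 + a ^+ 2)^-1.
have k0 : k != 0 by rewrite invr_eq0 gt_eqF // ltr_wpDr // sqr_ge0.
pose P : {poly R} := line_minor k%:P
  (1 + 'X * (crd 1 q)%:P) (1 + 'X * (crd 2 q)%:P) ('X * (crd 3 q)%:P) (1 + 'X * (crd 4 q)%:P)
  (1 + 'X * (crd 1 v)%:P) ('X * (crd 2 v)%:P) ('X * (crd 3 v)%:P) ('X * (crd 4 v)%:P).
have PE s : P.[s] = line_minor k
    (1 + s * crd 1 q) (1 + s * crd 2 q) (s * crd 3 q) (1 + s * crd 4 q)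
    (1 + s * crd 1 v) (s * crd 2 v) (s * crd 3 v) (s * crd 4 v).
  by rewrite /P horner_line_minor !hornerE.
have P0 : P != 0.
  apply/eqP => P0; have := PE 0; rewrite P0 horner0 /line_minor /fibre_minor => /esym/eqP.
  (* At s = 0 only the direction of the line is left, and it was chosen to have a nonzero minor. *)
  rewrite (_ : _ * _ = 3 * k); last by ring.
  by rewrite mulf_eq0 pnatr_eq0 (negPf k0).
by have [s Ms Ps] := poly_neq0_large M P0; exists s => //; rewrite -PE.
Qed.

Lemma minor_dense :
  phase Sing `<=` closure (phase Sing `&` [set x | minor x != 0]).
Proof.
move=> [q v] [[/= qq _] qv] B nB; rewrite /sphere /= in qq.
pose Q (e : R) := q + e *: row4 1 1 0 1.
pose V (e : R) := v + e *: row4 1 0 0 0.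
pose N e := dotr (Q e) (Q e); pose D e := dotr (Q e) (V e).
have Q0 : Q 0 = q by rewrite /Q scale0r addr0.
have V0 : V 0 = v by rewrite /V scale0r addr0.
have N0 : N 0 = 1 by rewrite /N Q0.
have D0 : D 0 = 0 by rewrite /D Q0 V0.
pose y e := ((Num.sqrt (N e))^-1 *: Q e, (N e)^-1 *: (N e *: V e - D e *: Q e)).
have y0 : y 0 = (q, v).
  by rewrite /y N0 D0 Q0 V0 sqrtr1 invr1 !scale1r scale0r subr0.
have yc : {for 0, continuous y}.
  have dl (u w : 'rV[R]_4) : is_derive (0 : R) (1 : R) (fun e : R => u + e *: w) w.
    have H1 := is_deriveZv (is_derive_id (0 : R^o) (1 : R^o)) (is_derive_cst w (0 : R^o) (1 : R^o)).
    apply: (is_derive_eq (is_deriveD (is_derive_cst u (0 : R^o) (1 : R^o)) H1)).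
    by rewrite scaler0 addr0 add0r scale1r.
  have dQ : is_derive (0 : R) (1 : R) Q _ := dl _ _.
  have dV : is_derive (0 : R) (1 : R) V _ := dl _ _.
  have dN := is_derive_dotr dQ dQ; have dD := is_derive_dotr dQ dV.
  have N00 : N 0 != 0 by rewrite N0 oner_eq0.
  have N0gt : 0 < N 0 by rewrite N0.
  have dS := is_derive1_comp (is_derive1_sqrt N0gt) dN.
  have S0 : (Num.sqrt \o N) 0 != 0 by rewrite /= N0 sqrtr1 oner_eq0.
  have dy := is_derive_pair (is_deriveZv (is_deriveV S0 dS) dQ)
    (is_deriveZv (is_deriveV N00 dN) (is_deriveB (is_deriveZv dN dV) (is_deriveZv dD dQ))).
  by apply: differentiable_continuous; apply/derivable1_diffP; case: dy.
have nB0 : nbhs (y 0) B by rewrite y0.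
have /nbhs_ballP[d d0 dB] := yc _ nB0.
(* The bound 1/d puts e = 1/s within the radius [d] on which [y] stays in [B]. *)
have [s ds] := line_minor_nearby q v d^-1; set m := line_minor _ _ _ _ _ _ _ _ _ => m0.
have s0 : 0 < s by rewrite (lt_trans _ ds) // invr_gt0.
pose e := s^-1.
have m0' : line_minor (1 + a ^+ 2)^-1 (crd 1 (Q e)) (crd 2 (Q e)) (crd 3 (Q e)) (crd 4 (Q e))
    (crd 1 (V e)) (crd 2 (V e)) (crd 3 (V e)) (crd 4 (V e)) != 0.
  rewrite (_ : line_minor _ _ _ _ _ _ _ _ _ = s^-1 ^+ 11 * m).
    by apply: mulf_neq0 => //; apply: expf_neq0; rewrite invr_eq0 gt_eqF.
  have e1 r : r + e * 1 = e * (1 + s * r) by rewrite /e; field; rewrite gt_eqF.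
  have e0 r : r + e * 0 = e * (s * r) by rewrite /e; field; rewrite gt_eqF.
  by rewrite /Q /V !crdE !e1 !e0 line_minorZ.
(* Were the position [Q e] zero, the minor would vanish. *)
have N0' : 0 < N e.
  rewrite lt0r dotrr_ge0 andbT; apply: contra m0' => /eqP /dotrr_eq0 ->.
  by rewrite !crd0 /line_minor /fibre_minor expr0n addr0 !(mulr0, mul0r).
have r0 : Num.sqrt (N e) != 0 by rewrite gt_eqF // sqrtr_gt0.
have rr : Num.sqrt (N e) ^+ 2 = N e by rewrite sqr_sqrtr // ltW.
have ym : minor (y e) != 0.
  suff -> : minor (y e) = (Num.sqrt (N e)) ^- 5 * (N e) ^- 2 *
      line_minor (1 + a ^+ 2)^-1 (crd 1 (Q e)) (crd 2 (Q e)) (crd 3 (Q e)) (crd 4 (Q e))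
    (crd 1 (V e)) (crd 2 (V e)) (crd 3 (V e)) (crd 4 (V e)).
    apply: mulf_neq0 => //; apply: mulf_neq0; rewrite invr_eq0; apply: expf_neq0 => //.
    by rewrite gt_eqF.
  by rewrite /minor /line_minor /y -!dotr4 -/(N e) -/(D e) /= !crdE fibre_minorZ !exprVn.
have sy : sphere (y e).1.
  rewrite /sphere /= dotrZl dotrZr -/(N e); move: r0 rr.
  by move: (Num.sqrt _) => r r0 <-; field.
exists (y e); split; [split=> //; split; first exact: minor_config|].
  by rewrite /= dotrZl dotrZr dotrBr !(dotrZr _ (Q e)) -/(N e) -/(D e); ring.
apply: dB; rewrite -ball_normE /= sub0r normrN gtr0_norm ?invr_gt0 //.
by rewrite -[d]invrK ltf_pV2 ?qualifE //= invr_gt0.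
Qed.

End Independence.

(** * Curves on quadrics *)

Section TangentKernel.
Context {R : realType} {n : nat}.
Implicit Types (B : set 'rV[R]_n.+1) (q w : 'rV[R]_n.+1).

(** Relative to [B], both [L] and 0 are differentials of [F], so they agree on the velocity of a
    curve in [B]. *)
Lemma tangent_to_kernel B (F L : 'rV[R]_n.+1 -> R) q w : is_diff q F L -> B q ->
  (forall y, B y -> F y = F q) -> tangent_to B q w -> L w = 0.
Proof.
move=> dF Bq FB [g [g0 Bg dg]]; rewrite -g0 in dF.
have cL : continuous L.
  by have [dF' <-] := dF; exact: diff_continuous.
have [_ <-] := is_diff_on_comp (is_diff_on_ex B dF) cL Bg dg.
have d0 : is_diff_on B F (g 0) (fun=> 0).
  have C : is_diff_on B (fun=> F q) (g 0) (fun=> 0).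
    by apply: is_diff_on_ex; exact: is_diff_cst.
  by apply: eq_is_diff_on C; [rewrite g0|move=> y; rewrite inE => /FB].
by have [_ ->] := is_diff_on_comp d0 (@cst_continuous _ _ _) Bg dg.
Qed.

End TangentKernel.

Section QuadricCurves.
Context {R : realType}.
Variables (al be : R).
Implicit Types (q w : 'rV[R]_4) (t : R).

Definition quadric q : Prop := al * crd 1 q ^+ 2 + be * crd 4 q ^+ 2 = 1.

Lemma is_derive_mul_sqrt (g h : R -> R) t dg : is_derive t 1 g dg ->
  is_derive t 1 h 0 -> h t = 1 -> is_derive t 1 (fun s => g s * Num.sqrt (h s)) dg.
Proof.
move=> dg' dh h1; have h0 : 0 < h t by rewrite h1.
have ds := is_derive1_comp (is_derive1_sqrt h0) dh.
apply: (is_derive_eq (is_deriveM dg' ds)).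
by rewrite /= h1 sqrtr1 mulr0 /GRing.scale /= mulr0 add0r mul1r.
Qed.

Lemma is_derive_row4 (g1 g2 g3 g4 : R -> R) t w :
  is_derive t 1 g1 (crd 1 w) -> is_derive t 1 g2 (crd 2 w) ->
  is_derive t 1 g3 (crd 3 w) -> is_derive t 1 g4 (crd 4 w) ->
  is_derive t 1 (fun s => row4 (g1 s) (g2 s) (g3 s) (g4 s)) w.
Proof.
have wE (i : 'I_4) : w ord0 i = crd i.+1 w by rewrite /crd inord_val.
move=> d1 d2 d3 d4; apply/is_derive_rowP => i; rewrite wE.
case: i => -[|[|[|[|//]]]] ki.
- by rewrite (_ : (fun s => _) = g1) //; apply/funext => s; rewrite mxE.
- by rewrite (_ : (fun s => _) = g2) //; apply/funext => s; rewrite mxE.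
- by rewrite (_ : (fun s => _) = g3) //; apply/funext => s; rewrite mxE.
- by rewrite (_ : (fun s => _) = g4) //; apply/funext => s; rewrite mxE.
Qed.

Lemma is_derive_continuous (V : normedModType R) (g : R -> V) t (w : V) :
  is_derive t 1 g w -> {for t, continuous g}.
Proof. by case=> dg _; apply: differentiable_continuous; apply/derivable1_diffP. Qed.

Lemma is_derive_near_gt0 (g : R -> R) t d : is_derive t 1 g d -> 0 < g t ->
  \forall s \near t, 0 < g s.
Proof. by move=> /is_derive_continuous /cvgr_gt; apply. Qed.

Lemma is_derive_line (x y : R) : is_derive (0 : R) 1 (fun s : R => x + s * y) y.
Proof. by apply: is_derive_eq; rewrite /GRing.scale /=; ring. Qed.

Lemma is_derive_sqr (g : R -> R) t d : is_derive t 1 g d ->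
  is_derive t 1 (fun s => g s ^+ 2) (2 * g t * d).
Proof. by move=> dg; apply: is_derive_eq; rewrite /GRing.scale /=; ring. Qed.

(** Start from the straight line. Scaling the (q1, q4) part by sqrt(X) restores the quadric, then
    scaling the (q2, q3) part by sqrt(Y) restores the sphere, which needs that part to be nonzero.
    As [w] solves the linearized equations, X and Y are 1 to first order and the velocity is
    kept. *)
Lemma quadric_curve_generic q w : sphere q -> quadric q -> dotr q w = 0 ->
  al * crd 1 q * crd 1 w + be * crd 4 q * crd 4 w = 0 ->
  0 < crd 2 q ^+ 2 + crd 3 q ^+ 2 ->
  exists g : R -> 'rV[R]_4, [/\ g 0 = q,
    \forall t \near 0, sphere (g t) /\ quadric (g t) & is_derive (0 : R) (1 : R) g w].
Proof.
move=> sq Qq qw Aw r0; have sq4 := sphere4 sq; rewrite /quadric in Qq.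
pose p k (t : R) := crd k q + t * crd k w.
have p0 k : p k 0 = crd k q by rewrite /p mul0r addr0.
have dp k : is_derive (0 : R) 1 (p k) (crd k w) by exact: is_derive_line.
have dp2 k := is_derive_sqr (dp k).
pose M t := al * p 1%N t ^+ 2 + be * p 4%N t ^+ 2.
pose n t := p 1%N t ^+ 2 + p 4%N t ^+ 2.
pose r t := p 2%N t ^+ 2 + p 3%N t ^+ 2.
have M0 : M 0 = 1 by rewrite /M !p0.
have dM : is_derive (0 : R) 1 M 0.
  have := is_deriveD (is_deriveZ al (dp2 1%N)) (is_deriveZ be (dp2 4%N)).
  move=> H; apply: (is_derive_eq H); rewrite /GRing.scale /= !p0.
  by rewrite -[RHS](mulr0 2) -Aw; ring.
have M0n : M 0 != 0 by rewrite M0 oner_eq0.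
pose X t := (M t)^-1.
have X0 : X 0 = 1 by rewrite /X M0 invr1.
have dX : is_derive (0 : R) 1 X 0.
  by apply: (is_derive_eq (is_deriveV M0n dM)); rewrite scaler0.
have dn : is_derive (0 : R) 1 n (2 * (crd 1 q * crd 1 w + crd 4 q * crd 4 w)).
  have H := is_deriveD (dp2 1%N) (dp2 4%N).
  by apply: (is_derive_eq H); rewrite !p0; ring.
have r00 : r 0 != 0 by rewrite /r !p0 gt_eqF.
have dr : is_derive (0 : R) 1 r (- (2 * (crd 1 q * crd 1 w + crd 4 q * crd 4 w))).
  have H := is_deriveD (dp2 2%N) (dp2 3%N).
  apply: (is_derive_eq H); rewrite !p0; move: qw; rewrite dotr4; lra.
pose Y t := (1 - n t * X t) * (r t)^-1.
have nr : 1 - n 0 = r 0 by rewrite /n /r !p0 -sq4; ring.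
have Y0 : Y 0 = 1 by rewrite /Y X0 mulr1 nr mulfV.
have dY : is_derive (0 : R) 1 Y 0.
  have H := is_deriveM (is_deriveB (is_derive_cst (1 : R) (0 : R) (1 : R)) (is_deriveM dn dX))
    (is_deriveV r00 dr).
  apply: (is_derive_eq H); rewrite /GRing.scale /= X0.
  have -> : (cst 1 - n * X) 0 = r 0 by rewrite -nr -[n 0]mulr1 -X0.
  by field.
exists (fun t => row4 (p 1%N t * Num.sqrt (X t)) (p 2%N t * Num.sqrt (Y t))
  (p 3%N t * Num.sqrt (Y t)) (p 4%N t * Num.sqrt (X t))); split.
- by rewrite X0 Y0 !p0 sqrtr1; apply: row4P; rewrite !crdE mulr1.
- have X1 : 0 < X 0 by rewrite X0.
  have Y1 : 0 < Y 0 by rewrite Y0.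
  have r1 : 0 < r 0 by rewrite /r !p0.
  apply: filterS3 (is_derive_near_gt0 dX X1) (is_derive_near_gt0 dY Y1)
    (is_derive_near_gt0 dr r1) => t X2 Y2 r2.
  rewrite /sphere /quadric /= dotr4 !crdE -!expr2 !exprMn !sqr_sqrtr ?ltW //.
  split; last first.
    transitivity (M t * X t); [by rewrite /M; ring|rewrite mulfV //].
    by apply: contraTneq X2 => M2; rewrite /X M2 invr0 ltxx.
  transitivity (n t * X t + r t * Y t); first by rewrite /n /r; ring.
  by rewrite /Y mulrCA mulfV ?gt_eqF // mulr1; ring.
- by apply: is_derive_row4; apply: is_derive_mul_sqrt.
Qed.

(** Here the linearized equations force w1 = w4 = 0, so (q2, q3) can move linearly while q1 and q4
    are corrected to second order. *)
Lemma quadric_curve_axis q w : al != 1 -> be != 1 -> sphere q -> quadric q -> dotr q w = 0 ->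
  al * crd 1 q * crd 1 w + be * crd 4 q * crd 4 w = 0 ->
  crd 2 q = 0 -> crd 3 q = 0 ->
  exists g : R -> 'rV[R]_4, [/\ g 0 = q,
    \forall t \near 0, sphere (g t) /\ quadric (g t) & is_derive (0 : R) (1 : R) g w].
Proof.
move=> al1 be1 sq Qq qw Aw q2 q3; have sq4 := sphere4 sq.
rewrite q2 q3 expr0n !addr0 in sq4; rewrite /quadric in Qq.
rewrite dotr4 q2 q3 !mul0r !addr0 in qw.
have q1n : crd 1 q != 0.
  apply: contra be1 => /eqP q1; rewrite q1 expr0n add0r in sq4.
  by rewrite q1 sq4 expr0n mulr0 add0r mulr1 in Qq; apply/eqP.
have q4n : crd 4 q != 0.
  apply: contra al1 => /eqP q4; rewrite q4 expr0n addr0 in sq4.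
  by rewrite q4 sq4 expr0n mulr0 addr0 mulr1 in Qq; apply/eqP.
have ab : be != al.
  by apply: contra al1 => /eqP ab; rewrite -Qq ab -mulrDr sq4 mulr1.
have w4 : crd 4 w = 0.
  apply: (mulIf (mulf_neq0 q4n (_ : be - al != 0))); rewrite ?subr_eq0 // mul0r.
  transitivity (al * crd 1 q * crd 1 w + be * crd 4 q * crd 4 w -
    al * (crd 1 q * crd 1 w + crd 4 q * crd 4 w)); first by ring.
  by rewrite Aw qw; ring.
have w1 : crd 1 w = 0.
  by apply: (mulfI q1n); rewrite mulr0 -[RHS]qw w4 mulr0 addr0.
have Q1 : (be - al) * crd 1 q ^+ 2 = be - 1.
  have E : be * (crd 1 q ^+ 2 + crd 4 q ^+ 2) = be by rewrite sq4 mulr1.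
  by rewrite -[X in X - 1]E -Qq; ring.
have Q4 : (be - al) * crd 4 q ^+ 2 = 1 - al.
  have E : al * (crd 1 q ^+ 2 + crd 4 q ^+ 2) = al by rewrite sq4 mulr1.
  by rewrite -[X in 1 - X]E -Qq; ring.
pose u := crd 2 w ^+ 2 + crd 3 w ^+ 2.
(* X and Y solve the equations of sphere and quadric, which are linear in the squares of the first
   and fourth coordinates. *)
pose X t := 1 + t ^+ 2 * (be * u / (1 - be)).
pose Y t := 1 + t ^+ 2 * (al * u / (1 - al)).
have d2 c : is_derive (0 : R) (1 : R) (fun t : R => 1 + t ^+ 2 * c) 0.
  by apply: is_derive_eq; rewrite /GRing.scale /=; ring.
have X0 : X 0 = 1 by rewrite /X expr0n mul0r addr0.
have Y0 : Y 0 = 1 by rewrite /Y expr0n mul0r addr0.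
have dX : is_derive (0 : R) (1 : R) X 0 := d2 _.
have dY : is_derive (0 : R) (1 : R) Y 0 := d2 _.
exists (fun t => row4 (crd 1 q * Num.sqrt (X t)) (t * crd 2 w) (t * crd 3 w)
  (crd 4 q * Num.sqrt (Y t))); split.
- by rewrite X0 Y0 sqrtr1 !mul0r !mulr1; apply: row4P; rewrite !crdE ?q2 ?q3.
- have X1 : 0 < X 0 by rewrite X0.
  have Y1 : 0 < Y 0 by rewrite Y0.
  apply: filterS2 (is_derive_near_gt0 dX X1) (is_derive_near_gt0 dY Y1) => t X2 Y2.
  have al0 : 1 - al != 0 by rewrite subr_eq0 eq_sym.
  have be0 : 1 - be != 0 by rewrite subr_eq0 eq_sym.
  have ab0 : be - al != 0 by rewrite subr_eq0.
  have Q1' : crd 1 q ^+ 2 = (be - 1) / (be - al) by rewrite -Q1; field.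
  have Q4' : crd 4 q ^+ 2 = (1 - al) / (be - al) by rewrite -Q4; field.
  rewrite /sphere /quadric /= dotr4 !crdE -!expr2 !exprMn !sqr_sqrtr ?ltW //.
  by rewrite Q1' Q4' /X /Y /u; split; field; rewrite ?al0 ?be0 ?ab0.
- have dc (c : R) : is_derive (0 : R) (1 : R) (fun=> c) 0 by exact: is_derive_cst.
  have dl (c : R) : is_derive (0 : R) (1 : R) (fun t => t * c) c.
    have H := is_derive_line 0 c.
    by rewrite (_ : (fun t => _) = fun t : R => 0 + t * c) //; apply/funext => t; rewrite add0r.
  apply: is_derive_row4 => //; rewrite ?w1 ?w4; exact: is_derive_mul_sqrt.
Qed.

End QuadricCurves.

(** * Reflections *)

Section Reflection.
Context {R : realType}.
Variables (al be : R).
Hypotheses (al1 : al != 1) (be1 : be != 1).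
Implicit Types (q v w : 'rV[R]_4) (B : set 'rV[R]_4).

Lemma quadric_curve q w : sphere q -> quadric al be q -> dotr q w = 0 ->
  al * crd 1 q * crd 1 w + be * crd 4 q * crd 4 w = 0 ->
  exists g : R -> 'rV[R]_4, [/\ g 0 = q,
    \forall t \near 0, sphere (g t) /\ quadric al be (g t) &
    is_derive (0 : R) (1 : R) g w].
Proof.
move=> sq Qq qw Aw.
have r0 : 0 <= crd 2 q ^+ 2 + crd 3 q ^+ 2 by rewrite addr_ge0 // sqr_ge0.
have [r1|r1] := ltP 0 (crd 2 q ^+ 2 + crd 3 q ^+ 2).
  exact: quadric_curve_generic.
have /eqP : crd 2 q ^+ 2 + crd 3 q ^+ 2 = 0 by apply/eqP; rewrite eq_le r1.
rewrite paddr_eq0 ?sqr_ge0 // !sqrf_eq0 => /andP[/eqP q2 /eqP q3].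
exact: quadric_curve_axis.
Qed.

(** The second clause says that [B] is open in the quadric as far as curves with a velocity at 0 can
    tell; it allows [B] to be a union of components. *)
Definition sphere_quadric B :=
  (forall q, B q -> sphere q /\ quadric al be q) /\
  (forall (g : R -> 'rV[R]_4) w, B (g 0) -> is_derive (0 : R) (1 : R) g w ->
    (\forall t \near 0, sphere (g t) /\ quadric al be (g t)) ->
    \forall t \near 0, B (g t)).

(* Half the gradient, along the sphere, of the equation of the quadric. *)
Definition quadric_normal q : 'rV[R]_4 :=
  row4 ((al - 1) * crd 1 q) (- crd 2 q) (- crd 3 q) ((be - 1) * crd 4 q).

(** Velocities annihilate the differentials of the two equations; conversely [quadric_curve]
    realizes every solution, and openness keeps its curve in [B]. *)
Lemma quadric_tangentP B q w : sphere_quadric B -> B q ->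
  tangent_to B q w <->
  dotr q w = 0 /\ al * crd 1 q * crd 1 w + be * crd 4 q * crd 4 w = 0.
Proof.
move=> [BQ QB] Bq; split=> [tw|[qw Aw]]; last first.
  have [sq Qq] := BQ _ Bq.
  have [g [g0 gQ dg]] := quadric_curve sq Qq qw Aw.
  by exists g; split=> //; apply: QB dg gQ; rewrite g0.
have d2 k := is_diff_fX2 (is_diff_crd k q).
have d1 := is_diff_fD (is_diff_fD (is_diff_fD (d2 1%N) (d2 2%N)) (d2 3%N)) (d2 4%N).
have dQ := is_diff_fD (is_diff_fC al (d2 1%N)) (is_diff_fC be (d2 4%N)).
have sqE y : B y -> crd 1 y ^+ 2 + crd 2 y ^+ 2 + crd 3 y ^+ 2 + crd 4 y ^+ 2 =
    crd 1 q ^+ 2 + crd 2 q ^+ 2 + crd 3 q ^+ 2 + crd 4 q ^+ 2.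
  by move=> /BQ[sy _]; rewrite !sphere4 //; have [] := BQ _ Bq.
have QE y : B y -> al * crd 1 y ^+ 2 + be * crd 4 y ^+ 2 =
    al * crd 1 q ^+ 2 + be * crd 4 q ^+ 2.
  by move=> /BQ[_ Qy]; have [_ Qq] := BQ _ Bq; rewrite Qy Qq.
have := tangent_to_kernel d1 Bq sqE tw; have := tangent_to_kernel dQ Bq QE tw.
move=> /= e1 e2; split.
- by rewrite dotr4; move: e2; lra.
- by move: e1; lra.
Qed.

Lemma quadric_normal_neq0 q : sphere q -> quadric_normal q <> 0.
Proof.
move=> sq n0; have n k : crd k (quadric_normal q) = 0 by rewrite n0 crd0.
have := sphere4 sq; move: (n 1%N) (n 2%N) (n 3%N) (n 4%N); rewrite /quadric_normal !crdE.
move=> /eqP; rewrite mulf_eq0 subr_eq0 (negPf al1) /= => /eqP ->.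
move=> /eqP; rewrite oppr_eq0 => /eqP ->; move=> /eqP; rewrite oppr_eq0 => /eqP ->.
move=> /eqP; rewrite mulf_eq0 subr_eq0 (negPf be1) /= => /eqP ->.
by rewrite expr0n !addr0 => /esym/eqP; rewrite oner_eq0.
Qed.

Lemma quadric_reflects B q v v' : sphere_quadric B -> B q -> reflects B q v v' ->
  exists vt c, [/\ dotr q vt = 0,
    al * crd 1 q * crd 1 vt + be * crd 4 q * crd 4 vt = 0,
    v = vt + c *: quadric_normal q & v' = vt - c *: quadric_normal q].
Proof.
move=> sB Bq [vt [vn [/(quadric_tangentP _ sB Bq)[qt At] [qn tn] -> ->]]].
have [sq Qq] := sB.1 _ Bq.
pose n := quadric_normal q.
have n0 : dotr n n != 0 by apply/eqP => /dotrr_eq0; exact: quadric_normal_neq0.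
have qE w : dotr n w = al * crd 1 q * crd 1 w + be * crd 4 q * crd 4 w - dotr q w.
  by rewrite !dotr4 /n /quadric_normal !crdE; ring.
have qn0 : dotr q n = 0.
  rewrite dotrC qE; have -> : dotr q q = 1 by [].
  by rewrite -!mulrA -!expr2 Qq subrr.
pose c := dotr n vn / dotr n n.
(* The part of [vn] orthogonal to [n] is tangent to the wall, hence orthogonal to [vn] as well as to
   [n], hence to itself. *)
have [w wE] : exists w, w = vn - c *: n by eexists.
have nw : dotr n w = 0 by rewrite wE !dotrE /c divfK // subrr.
have qw : dotr q w = 0 by rewrite wE !dotrE qn qn0 mulr0 subrr.
have tw : tangent_to B q w.
  by apply/(quadric_tangentP _ sB Bq); split=> //; have := qE w; rewrite nw qw; lra.
have w0 : w = 0.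
  apply: dotrr_eq0; rewrite {2}wE dotrBr dotrZr (tn _ tw) dotrC nw.
  by rewrite mulr0 subrr.
have vnE : vn = c *: n by apply/eqP; rewrite -subr_eq0 -wE; apply/eqP.
by exists vt, c; rewrite -/n -vnE.
Qed.

End Reflection.

(** Reversing the normal part changes a quadratic integral only by its cross term between [vt] and
    the normal; [Lhat_yz] is linear in the velocity and vanishes on the normal. *)
Lemma sphere_quadric_invariant (R : realType) (a mh1 mh2 f al be : R)
    (B : set 'rV[R]_4) (i : 'I_3) : al != 1 -> be != 1 ->
  al + a ^+ 2 * be = (1 + a ^+ 2) * al * be -> sphere_quadric al be B ->
  reflection_invariant (lagrange_sing a mh1 mh2 f) B
    (tnth (lagrange_integrals a mh1 mh2 f) i).
Proof.
move=> al1 be1 ab sB q v v' _ Bq rv.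
have [vt [c [qt At -> ->]]] := quadric_reflects al1 be1 sB Bq rv.
have [sq Qq] := sB.1 _ Bq; have sq4 := sphere4 sq.
set n := quadric_normal al be q.
have nt : dotr vt n = 0.
  rewrite /n /quadric_normal dotr4 !crdE.
  transitivity (al * crd 1 q * crd 1 vt + be * crd 4 q * crd 4 vt - dotr q vt).
    by rewrite dotr4; ring.
  by rewrite qt At subrr.
case: i => -[|[|[|//]]] ki; rewrite (tnth_nth (@Lhat_yz R)) /=.
- by rewrite /E_sph /= !dotrE (dotrC n) nt; ring.
- have S0 : 1 + a ^+ 2 != 0 by rewrite gt_eqF // ltr_wpDr // sqr_ge0.
  pose W (u : 'rV[R]_4) k := crd 4 q * crd k u - crd k q * crd 4 u.
  have cross : W vt 1%N * W n 1%N / (1 + a ^+ 2) + W vt 2%N * W n 2%N + W vt 3%N * W n 3%N = 0.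
    rewrite /W /n /quadric_normal !crd_row4; rewrite dotr4 in qt; rewrite /quadric in Qq.
    apply: (mulIf S0); rewrite mul0r; set S := 1 + a ^+ 2.
    (* An explicit combination of tangency to the sphere, the sphere equation, confocality, tangency
       to the quadric and the quadric equation. *)
    transitivity (
      - be * S * crd 4 q ^+ 2 * (crd 1 q * crd 1 vt + crd 2 q * crd 2 vt +
        crd 3 q * crd 3 vt + crd 4 q * crd 4 vt) +
      be * S * crd 4 q * crd 4 vt *
        (crd 1 q ^+ 2 + crd 2 q ^+ 2 + crd 3 q ^+ 2 + crd 4 q ^+ 2 - 1) +
      crd 4 q * (al + a ^+ 2 * be - S * al * be) *
        (crd 4 q * crd 1 q * crd 1 vt - crd 4 vt * crd 1 q ^+ 2) +
      S * be * crd 4 q ^+ 2 * (al * crd 1 q * crd 1 vt + be * crd 4 q * crd 4 vt) -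
      S * be * crd 4 q * crd 4 vt * (al * crd 1 q ^+ 2 + be * crd 4 q ^+ 2 - 1)).
      by rewrite /S; field.
    by rewrite qt sq4 ab At Qq /S; ring.
  rewrite /Ehat_sp /= !(crdD, crdN, crdZ).
  congr (_ - _ + _ + _); apply/eqP; rewrite -subr_eq0; apply/eqP.
  by rewrite -[RHS](mulr0 (2 * c)) -cross /W; field.
- by rewrite /Lhat_yz /= /n /quadric_normal !(crdD, crdN, crdZ) !crd_row4; ring.
Qed.

(** * Confocal quadrics *)

(** The cosine is injective on [0, pi], and beyond pi the symmetry x -> 2 pi - x leads back there;
    at pi itself this symmetry would break injectivity. *)
Lemma cos_local_inj (R : realType) (c : R) : 0 < c -> c < 2 * pi -> c <> pi ->
  \forall x \near c, cos x = cos c -> x = c.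
Proof.
move=> c0 c2 cpi.
have gt y : y < c -> \forall x \near c, y < x.
  by move=> yc; apply: (cvgr_gt _ (@cvg_id _ (nbhs c))).
have lt y : c < y -> \forall x \near c, x < y.
  by move=> yc; apply: (cvgr_lt _ (@cvg_id _ (nbhs c))).
have [cp|pc] : c < pi \/ pi < c by case: (ltgtP c pi) cpi => //; [left|right].
  apply: filterS2 (gt _ c0) (lt _ cp) => x x0 xp; apply: cos_inj.
    by rewrite in_itv /= !ltW.
  by rewrite in_itv /= !ltW.
apply: filterS2 (gt _ pc) (lt _ c2) => x xp x2 e.
have cosE y : cos y = cos (2 * pi - y) :> R.
  by rewrite -[RHS]cosN opprB mulr_natl -[RHS]cosD2pi subrK.
rewrite cosE (cosE c) in e.
suff : 2 * pi - x = 2 * pi - c by move/addrI/oppr_inj.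
by apply: cos_inj e; rewrite in_itv /=; lra.
Qed.

Section Confocal.
Context {R : realType}.
Variables (a k : R).
Hypotheses (kN1 : -1 < k) (k1 : k < 1)
  (kd : k != (1 - a ^+ 2) / (1 + a ^+ 2)).
Implicit Types (q v w : 'rV[R]_4) (B : set 'rV[R]_4).

(** Here k is the cosine of the constant of the quadric. The form c1^2 + c2^2 - 2 k c1 c2 is (1 -
    k)/2 (c1 + c2)^2 + (1 + k)/2 (c1 - c2)^2, where the sum is proportional to q4 and the difference
    to q1; dividing by 1 - k^2 gives the two coefficients. *)
Definition confocal_al : R := 2 * a ^+ 2 / ((1 + a ^+ 2) * (1 - k)).
Definition confocal_be : R := 2 / ((1 + a ^+ 2) * (1 + k)).
Local Notation Q := (quadric confocal_al confocal_be).

Let S0 : 1 + a ^+ 2 != 0.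
Proof. by rewrite gt_eqF // ltr_wpDr // sqr_ge0. Qed.

Let km : 1 - k != 0. Proof. by rewrite subr_eq0 gt_eqF. Qed.

Let kp : 1 + k != 0.
Proof. by rewrite gt_eqF // -ltrBlDl sub0r. Qed.

(** Coefficient 1 would mean that k is the cosine of the distance between the foci, the degenerate
    value excluded by [kd]. *)
Lemma confocal_al_neq1 : confocal_al != 1.
Proof.
apply: contra kd => /eqP e; apply/eqP; apply: (mulIf S0); rewrite divfK //.
have : confocal_al * ((1 + a ^+ 2) * (1 - k)) = 2 * a ^+ 2 by rewrite divfK // mulf_neq0.
by rewrite e; lra.
Qed.

Lemma confocal_be_neq1 : confocal_be != 1.
Proof.
apply: contra kd => /eqP e; apply/eqP; apply: (mulIf S0); rewrite divfK //.
have : confocal_be * ((1 + a ^+ 2) * (1 + k)) = 2 by rewrite divfK // mulf_neq0.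
by rewrite e; lra.
Qed.

Lemma confocal_alE : confocal_al + a ^+ 2 * confocal_be = (1 + a ^+ 2) * confocal_al * confocal_be.
Proof. by rewrite /confocal_al /confocal_be; field; rewrite S0 km kp. Qed.

(** At a focus or its antipode the equation, multiplied by 1 - k^2, becomes (k - cos d)^2 = 0 with d
    the focal distance. *)
Lemma quadric_neq_focus b q : b ^+ 2 = a ^+ 2 -> Q q -> q <> Z1 b /\ q <> - Z1 b.
Proof.
move=> ba; suff H : crd 1 q ^+ 2 = a ^+ 2 / (1 + a ^+ 2) ->
    crd 4 q ^+ 2 = (1 + a ^+ 2)^-1 -> Q q -> False.
  have ss := sqr_sqrt1D2 b; rewrite ba in ss.
  by move=> Qq; split=> qZ; apply: H => //;
    rewrite qZ /Z1 !crdE ?sqrrN expr_div_n ba ss ?expr1n ?div1r.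
rewrite /quadric => -> -> e; move/negP: kd; apply; rewrite -subr_eq0 -sqrf_eq0; apply/eqP.
transitivity ((1 - k ^+ 2) * (confocal_al * (a ^+ 2 / (1 + a ^+ 2)) + confocal_be / (1 + a ^+ 2) - 1)).
  by rewrite /confocal_al /confocal_be; field; rewrite S0 km kp.
by rewrite e subrr mulr0.
Qed.

Lemma confocal_factor q : sphere q ->
  (cos (theta (Z1 a) q + theta (Z2 a) q) - k) *
  (cos (theta (Z1 a) q - theta (Z2 a) q) - k) =
  (1 - k ^+ 2) * (confocal_al * crd 1 q ^+ 2 + confocal_be * crd 4 q ^+ 2 - 1).
Proof.
move=> sq; rewrite Z2E cosD cosB /theta !sin_acos ?dotr_Z1_bound //.
rewrite !acosK ?in_itv ?dotr_Z1_bound //.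
have r0 b := sqr_sqrtr (sqr_sin_theta_ge0 b sq).
have c1 := dotr_Z1 a q; have c2 := dotr_Z1 (- a) q; rewrite sqrrN in c2.
have s0 := lt0r_neq0 (sqrt1D2_gt0 a); have ss := sqr_sqrt1D2 a.
move: (r0 a) (r0 (- a)) c1 c2 => {r0}.
move: (Num.sqrt (1 - _)) => r1; move: (Num.sqrt (1 - _)) => r2.
move: (dotr _ _) => x1; move: (dotr _ _) => x2.
move: (Num.sqrt _) s0 ss => s s0 ss e1 e2 E1 E2.
transitivity (x1 ^+ 2 + x2 ^+ 2 - 2 * k * x1 * x2 + k ^+ 2 - 1).
  transitivity ((x1 * x2 - k) ^+ 2 - r1 ^+ 2 * r2 ^+ 2); first by ring.
  by rewrite e1 e2; ring.
by rewrite E1 E2 /confocal_al /confocal_be -ss; field; rewrite s0 km kp.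
Qed.

(** The boolean treats spheroids ([false], sum of angles) and hyperboloids ([true], difference)
    together. *)
Lemma confocal_quadric_eq (sg : bool) q : sphere q ->
  cos (theta (Z1 a) q + (-1) ^+ sg * theta (Z2 a) q) = k -> Q q.
Proof.
move=> sq e; have := confocal_factor sq.
have -> : (cos (theta (Z1 a) q + theta (Z2 a) q) - k) *
  (cos (theta (Z1 a) q - theta (Z2 a) q) - k) = 0.
  by case: sg e => /=; rewrite ?expr0 ?expr1 ?mul1r ?mulN1r => ->; rewrite subrr ?mulr0 ?mul0r.
have k2 : 1 - k ^+ 2 != 0 by rewrite (_ : _ - _ = (1 - k) * (1 + k)) ?mulf_neq0 //; ring.
by move=> /esym/eqP; rewrite mulf_eq0 (negPf k2) /= subr_eq0 => /eqP.
Qed.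

Lemma continuous_theta b (g : R -> 'rV[R]_4) w :
  is_derive (0 : R) (1 : R) g w -> sphere (g 0) -> g 0 <> Z1 b -> g 0 <> - Z1 b ->
  {for 0, continuous (fun t => theta (Z1 b) (g t))}.
Proof.
move=> dg sg n1 n2.
have D0 := sqr_sin_theta_gt0 sg n1 n2.
have c1 : -1 < dotr (g 0) (Z1 b) < 1 by apply/andP; split; nra.
have gc : {for 0, continuous (fun t => dotr (g t) (Z1 b))}.
  have := is_derive_dotr dg (is_derive_cst (Z1 b) (0 : R^o) (1 : R^o)).
  exact: is_derive_continuous.
exact: (continuous_comp gc (continuous_acos c1)).
Qed.

Lemma near_zero_branch (F G : R -> R) : {for 0, continuous F} -> {for 0, continuous G} ->
  (\forall t \near 0, F t * G t = 0) -> G 0 != 0 -> \forall t \near 0, F t = 0.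
Proof.
move=> cF cG FG G0.
have : \forall t \near 0, G t != 0 by have := cG _ (open_neq G0).
by apply: filterS2 FG => t /eqP; rewrite mulf_eq0 => /orP[/eqP //|->].
Qed.

(** On the quadric the product of [confocal_factor] vanishes; the factor of the other sign is
    nonzero at 0, so by continuity the same factor keeps vanishing. *)
Lemma confocal_near (sg : bool) (g : R -> 'rV[R]_4) w :
  let ang (t : bool) y := theta (Z1 a) y + (-1) ^+ t * theta (Z2 a) y in
  sphere (g 0) -> Q (g 0) -> cos (ang sg (g 0)) = k ->
  is_derive (0 : R) (1 : R) g w -> (\forall t \near 0, sphere (g t) /\ Q (g t)) ->
  {for 0, continuous (fun t => ang sg (g t))} /\ \forall t \near 0, cos (ang sg (g t)) = k.
Proof.
move=> ang sg0 Q0 ang0 dg gQ.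
have [n1 n2] := quadric_neq_focus (erefl _) Q0.
have [n3 n4] := quadric_neq_focus (sqrrN a) Q0.
have t1 := continuous_theta dg sg0 n1 n2.
have t2 := continuous_theta dg sg0 n3 n4; rewrite -Z2E in t2.
have cang b : {for 0, continuous (fun t => ang b (g t))}.
  apply: (continuousD t1); apply: continuousM t2; exact: cst_continuous.
have ccos b : {for 0, continuous (fun t => cos (ang b (g t)) - k)}.
  apply: continuousB; last exact: cst_continuous.
  exact: (continuous_comp (cang b) (@continuous_cos R _)).
split=> //.
have FG : \forall t \near 0, (cos (ang sg (g t)) - k) * (cos (ang (~~ sg) (g t)) - k) = 0.
  apply: filterS gQ => t [st Qt].
  have := confocal_factor st; rewrite Qt subrr mulr0.
  rewrite /ang; case: (sg) => /=; rewrite expr0 expr1 mul1r mulN1r //.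
  by rewrite mulrC.
(* The two cosines differ by twice the product of the sines, which is nonzero away from the foci and
   their antipodes. *)
have G0 : cos (ang (~~ sg) (g 0)) - k != 0.
  rewrite -ang0.
  have s1 := sin_theta_gt0 sg0 n1 n2.
  have s2 := sin_theta_gt0 sg0 n3 n4.
  have sE b : sin_theta b (g 0) = sin (theta (Z1 b) (g 0)).
    by rewrite /theta sin_acos // dotr_Z1_bound.
  rewrite !sE -Z2E in s1 s2.
  have s12 := mulr_gt0 s1 s2.
  rewrite /ang; case: (sg) => /=; rewrite !expr0 !expr1 !mul1r !mulN1r !cosD !sinN !cosN;
    by apply/eqP => e; move: s12; lra.
have := near_zero_branch (ccos sg) (ccos (~~ sg)) FG G0.
by apply: filterS => t /eqP; rewrite subr_eq0 => /eqP.
Qed.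

End Confocal.

(** With k = cos c, a curve on the quadric keeps the cosine of the sum or difference of angles equal
    to cos c; continuity and [cos_local_inj] then keep the sum, or the absolute difference, equal to
    c. *)
Lemma confocal_sphere_quadric (R : realType) (a : R) (B : set 'rV[R]_4) :
  confocal_quadric (Z1 a) (Z2 a) B ->
  exists al be, [/\ al != 1, be != 1, al + a ^+ 2 * be = (1 + a ^+ 2) * al * be &
    sphere_quadric al be B].
Proof.
move=> cB.
have S0 : 1 + a ^+ 2 != 0 by rewrite gt_eqF // ltr_wpDr // sqr_ge0.
have sZ : sphere (Z2 a).
  rewrite /sphere /= dotr4 /Z2 !crdE; have := sqr_sqrt1D2 a; have := lt0r_neq0 (sqrt1D2_gt0 a).
  move: (Num.sqrt _) => s s0 ss; apply: (mulIf (expf_neq0 2 s0)).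
  transitivity (1 + a ^+ 2); first by field.
  by rewrite mul1r ss.
have bZ := dotr_Z1_bound a sZ.
set d := theta (Z1 a) (Z2 a) in cB.
have dE : cos d = (1 - a ^+ 2) / (1 + a ^+ 2).
  rewrite /d /theta acosK ?in_itv //= dotr_Z1 /Z2 !crdE.
  have := sqr_sqrt1D2 a; have := lt0r_neq0 (sqrt1D2_gt0 a).
  by move: (Num.sqrt _) => s s0 <-; field.
have d0 : 0 <= d by exact: acos_ge0.
have dpi : d <= pi by exact: acos_lepi.
have cosP c : 0 < c < pi -> c != d -> [/\ -1 < cos c, cos c < 1 & cos c != (1 - a ^+ 2) / (1 + a ^+ 2)].
  move=> /andP[c0 c1] cd; rewrite -dE; split.
  - by rewrite -cospi ltr_cos // in_itv /= ?lexx ?pi_ge0 ?ltW.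
  - by rewrite -cos0 ltr_cos // in_itv /= ?lexx ?pi_ge0 ?ltW.
  - apply: contra cd => /eqP /cos_inj H; apply/eqP/H; rewrite in_itv /= ?d0 ?dpi //.
    by rewrite !ltW.
move: cB; rewrite /confocal_quadric -/d => -[[c [dc cd cpi ->]]|[c [c0 cd ->]]].
  have c0 : 0 < c by exact: le_lt_trans dc.
  have c2 : c < 2 * pi by lra.
  have [k1 k2 kd] : [/\ -1 < cos c, cos c < 1 & cos c != (1 - a ^+ 2) / (1 + a ^+ 2)].
    have [cp|pc] : c < pi \/ pi < c by case: (ltgtP c pi) cpi => //; [left|right].
      by apply: cosP; rewrite ?c0 // gt_eqF.
    (* The bound c < 2 pi - d puts the reflected angle strictly between d and pi. *)
    have -> : cos c = cos (2 * pi - c) :> R.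
      by rewrite -[RHS]cosN opprB mulr_natl -[RHS]cosD2pi subrK.
    apply: cosP; first by apply/andP; split; lra.
    by rewrite gt_eqF //; lra.
  exists (confocal_al a (cos c)), (confocal_be a (cos c)); split.
  - exact: confocal_al_neq1.
  - exact: confocal_be_neq1.
  - exact: confocal_alE.
  have angE q : theta (Z1 a) q + theta (Z2 a) q =
      theta (Z1 a) q + (-1) ^+ false * theta (Z2 a) q by rewrite expr0 mul1r.
  have cQ q : spheroid (Z1 a) (Z2 a) c q -> quadric (confocal_al a (cos c)) (confocal_be a (cos c)) q.
    by move=> [sq qc]; apply: (@confocal_quadric_eq _ _ _ _ _ false) => //; rewrite -angE qc.
  split=> [q Bq|g w B0 dg gQ]; first by split; [case: Bq|exact: cQ].
  have [s0 t0] := B0.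
  have [] := @confocal_near _ a (cos c) _ _ _ false g w s0 (cQ _ B0) _ dg gQ => //.
    by rewrite -angE t0.
  move=> ct ck.
  have loc : \forall x \near theta (Z1 a) (g 0) + (-1) ^+ false * theta (Z2 a) (g 0),
      cos x = cos c -> x = c.
    by rewrite -angE t0; exact: cos_local_inj.
  apply: filterS3 gQ ck (ct _ loc) => t [st _] ckt /(_ ckt) tc.
  by split=> //; rewrite angE.
have [k1 k2 kd] : [/\ -1 < cos c, cos c < 1 & cos c != (1 - a ^+ 2) / (1 + a ^+ 2)].
  by apply: cosP; rewrite ?c0 ?(lt_le_trans cd) // lt_eqF.
exists (confocal_al a (cos c)), (confocal_be a (cos c)); split.
- exact: confocal_al_neq1.
- exact: confocal_be_neq1.
- exact: confocal_alE.
have cos_abs x : cos `|x| = cos x :> R by case: (ger0P x) => _; rewrite ?cosN.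
have angE q : theta (Z1 a) q - theta (Z2 a) q =
    theta (Z1 a) q + (-1) ^+ true * theta (Z2 a) q by rewrite expr1 mulN1r.
have cQ q : hyperboloid (Z1 a) (Z2 a) c q -> quadric (confocal_al a (cos c)) (confocal_be a (cos c)) q.
  by move=> [sq qc]; apply: (@confocal_quadric_eq _ _ _ _ _ true) => //; rewrite -angE -cos_abs qc.
split=> [q Bq|g w B0 dg gQ]; first by split; [case: Bq|exact: cQ].
have [s0 t0] := B0.
have [] := @confocal_near _ a (cos c) _ _ _ true g w s0 (cQ _ B0) _ dg gQ => //.
  by rewrite -angE -cos_abs t0.
move=> ct ck.
have loc : \forall x \near `|theta (Z1 a) (g 0) + (-1) ^+ true * theta (Z2 a) (g 0)|,
    cos x = cos c -> x = c.
  have cpi : c < pi by exact: lt_le_trans cd _.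
  have pi0 : 0 < pi :> R by exact: pi_gt0.
  by rewrite -angE t0; apply: cos_local_inj => //; [lra|apply/eqP; rewrite lt_eqF].
have ct' := continuous_comp ct (@norm_continuous _ _ _).
apply: filterS3 gQ ck (ct' _ loc) => t [st _] ckt; rewrite /= cos_abs => /(_ ckt) tc.
by split=> //; rewrite angE.
Qed.

Theorem theorem3 (R : realType) (a mh1 mh2 f : R) (ha : a != 0)
    (k : nat) (B : 'I_k -> set 'rV[R]_4)
    (hB : forall j, confocal_quadric (Z1 a) (Z2 a) (B j)) :
  billiard_integrable (lagrange_force a mh1 mh2 f)
    (lagrange_sing a mh1 mh2 f) B /\
  integrable_with (lagrange_force a mh1 mh2 f)
    (lagrange_sing a mh1 mh2 f) B (lagrange_integrals a mh1 mh2 f).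
Proof.
suff H : integrable_with (lagrange_force a mh1 mh2 f)
    (lagrange_sing a mh1 mh2 f) B (lagrange_integrals a mh1 mh2 f).
  by split=> //; exists (lagrange_integrals a mh1 mh2 f).
split.
- exact: lagrange_first_integral.
- exists [set x | minor a x != 0]; split.
  + exact: open_minor.
  + exact: minor_dense.
  + by move=> x px mx; exact: minor_independent.
- exact: lagrange_involution.
- move=> i j; have [al [be [al1 be1 ab sB]]] := confocal_sphere_quadric (hB j).
  exact: sphere_quadric_invariant al1 be1 ab sB.
Qed.
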